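(* Let $\rho \in \left[\frac{17}{25}, \frac{7}{10}\right]$ and $\alpha \in \left[\frac{1}{3}, \frac{2}{5}\right]$ be real numbers. Then $$I\left(S_2,\rho,\alpha,\tfrac15\right) = \max\left\{2\rho-1+(1-\rho)^{3/2},\ \alpha^3+(\rho-\alpha^2)\sqrt{\rho+\alpha^2}\right\}.$$
   Context: All graphs are finite and simple. $S_2$ denotes the star with two edges (the path on three vertices). For a graph $G$, $N(S_2,G)$ is the number of (not necessarily induced) subgraphs of $G$ isomorphic to $S_2$, i.e. $N(S_2,G)=\sum_{v\in V(G)}\binom{d_G(v)}{2}$, where $d_G(v)$ is the degree of $v$. For a graph $G$ on $n$ vertices, its $S_2$-density is $\rho(S_2,G) = \frac{N(S_2,G)}{3\binom{n}{3}}$. For $S\subseteq V(G)$ let $\delta_G(S)=\min\{d_G(v): v\in S\}$. For nonnegative integers $n,m,\ell,k$ with $m\le\binom n2$ and $k\ell\le m$, let $\mathcal{G}(n,m,\ell,k)$ be the family of all graphs $G$ on $n$ vertices with exactly $m$ edges that contain an independent set $I$ with $|I|\ge \ell$ and $\delta_G(I)\ge k$. For real numbers $\rho,\alpha,\beta\in[0,1]$ define $$I(S_2,\rho,\alpha,\beta)=\limsup_{n\to\infty}\ \max\left\{\rho(S_2,G): G\in\mathcal{G}\left(n,\left\lfloor\rho\tbinom n2\right\rfloor,\lfloor\alpha n\rfloor,\lfloor\beta n\rfloor\right)\right\}.$$ *)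

(* Defs.v *)
From HB Require Import structures.
From mathcomp Require Import all_boot all_order all_algebra.
From mathcomp Require Import all_classical all_reals all_analysis.

Set Implicit Arguments.
Unset Strict Implicit.
Unset Printing Implicit Defensive.

Import Order.TTheory GRing.Theory Num.Theory.
Local Open Scope nat_scope.

(* A simple graph on the vertex set 'I_n is the set of its edges, each edge
   being a set of two vertices. *)
Definition graph (n : nat) : finType :=
  {E : {set {set 'I_n}} | [forall e in E, #|e : {set 'I_n}| == 2]}.

Definition edges n (G : graph n) : {set {set 'I_n}} := val G.

Definition degree n (G : graph n) (v : 'I_n) : nat :=
  #|[set e in edges G | v \in e]|.

Definition independent n (G : graph n) (I : {set 'I_n}) : bool :=
  [forall e in edges G, ~~ (e \subset I)].

(* Degrees are at most n.-1, so the neutral element n does not affect the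
   minimum over a nonempty S. *)
Definition min_degree n (G : graph n) (S : {set 'I_n}) : nat :=
  \big[minn/n]_(v in S) degree G v.

Definition nb_S2 n (G : graph n) : nat := \sum_(v < n) 'C(degree G v, 2).

(* The constraints m <= 'C(n, 2) and k * l <= m, under which this family is
   considered, hold whenever it is nonempty: the l vertices of an independent
   set of minimum degree at least k are incident to l * k distinct edges. *)
Definition graph_family (n m l k : nat) : {set graph n} :=
  [set G : graph n | (#|edges G| == m) &&
     [exists I : {set 'I_n},
        [&& independent G I, l <= #|I| & k <= min_degree G I]]].

Local Open Scope ring_scope.

Section Density.
Variable R : realType.

Definition density_S2 n (G : graph n) : R :=
  (nb_S2 G)%:R / (3 * ('C(n, 3))%:R).

(* Densities are nonnegative, so this is the maximum when the family is
   nonempty; it is 0 for an empty family. *)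
Definition max_density_S2 (n m l k : nat) : R :=
  \big[Num.max/0]_(G in graph_family n m l k) density_S2 G.

(* Num.truncn is the floor on nonnegative reals. *)
Definition I_S2 (rho alpha beta : R) : \bar R :=
  limn_esup (fun n : nat =>
    (max_density_S2 n (Num.truncn (rho * ('C(n, 2))%:R))
       (Num.truncn (alpha * n%:R)) (Num.truncn (beta * n%:R)))%:E).

End Density.

(* Main.v *)
(**
Normalise by n and write a = |I|/n, b = k/n; the density of G is then the sum of
d(v)^2 over n^3.  Both values in the theorem come from a clique K completely joined
to an independent set W, all other vertices being isolated: W is the complement of
K for the first value and W = I for the second.  Inserting edges not contained in I
makes the number of edges right, which gives the lower bound.

For the upper bound take G maximising the sum of d(v)^2, and then I minimising the
sum of the degrees over I.  Replacing an edge by a non-edge with a larger degree sum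
is impossible, so neighbourhoods outside I are nested and the complement of I splits
into a clique C and an independent set O.  If f(j) is the number of neighbours in C
of a vertex j outside C, then, up to the edges between I and O, the part of the sum
of squares not determined by |C| and the number of edges is at most the sum of the
f(j)^2 and of all the min(f(i), f(j)).  Subject to f >= k on I, this is bounded by
truncating f at k and estimating both layers separately.  Edges between I and O
contribute little: their end in O has low degree, since otherwise vertices of O could
replace vertices of I, contradicting the choice of I.  The remaining inequality in
t = |C|/n follows from convexity in u, where k u is the sum of the truncated f.
*)

Require Import Defs.
From mathcomp Require Import all_boot all_order all_algebra.
From mathcomp Require Import zify ring lra.
Import Order.TTheory GRing.Theory Num.Theory.
Local Open Scope ring_scope.

Set Implicit Arguments.
Unset Strict Implicit.
Unset Printing Implicit Defensive.

(** * Inequalities between normalised densities *)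

Section Optimization.
Variable R : realFieldType.
Implicit Types (a b d m p q r s t u x z K L M N P S T : R).

(* Throughout the section, t = |C|/n, r is the edge density, and q and s are given by
   q^2 = 1 - r and s^2 + 2 a s = r: the extremal graphs have a clique of size
   (1 - q) n, respectively s n, and values 1 - 2 q^2 + q^3, respectively
   s^3 + 3 a s^2 + a^2 s.  As |I|/n, k/n and r only converge to alpha, 1/5 and rho,
   the constants leave some room around the ranges in the theorem. *)

(** This is the estimate with a single layer of width [z], for a clique of size [1 - z]. The gap has
    the double root [z = q], attained by the extremal graph, and the hypothesis gives the sign of
    the remaining factor. *)
Lemma columns_le_quasi_star q z (P := (1 - q ^+ 2 - (1 - z) ^+ 2) / 2) :
  0 < z -> q ^+ 2 <= z ^+ 2 + 2 * q * z ->
  (1 - z) ^+ 3 + 2 * (1 - z) * P + P * (z + P / z) <= 1 - 2 * q ^+ 2 + q ^+ 3.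
Proof.
move=> z0 h; rewrite -subr_ge0.
have -> : 1 - 2 * q ^+ 2 + q ^+ 3 -
  ((1 - z) ^+ 3 + 2 * (1 - z) * P + P * (z + P / z)) =
  (z - q) ^+ 2 * (z ^+ 2 + 2 * q * z - q ^+ 2) / (4 * z).
  by rewrite /P; field; rewrite gt_eqF.
apply: divr_ge0; last by clear -z0; lra.
by apply: mulr_ge0; [exact: sqr_ge0 | clear -h; lra].
Qed.

(** The two-layer estimate at its right end [u = z]. In the gap the square of [2 * p - z * v] has a
    nonnegative coefficient and is dropped; in the rest [v] and [q] are replaced by their extreme
    values [37/46 - z] and [25/46]. *)
Lemma two_level_le_quasi_star q z b (P := (1 - q ^+ 2 - (1 - z) ^+ 2) / 2) (v := 1 - z - b) :
  25/46 <= q <= 4/7 -> 15/46 <= z <= v -> 9/46 <= b ->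
  (1 - z) ^+ 3 + 2 * (1 - z) * P + (b * z ^+ 2 + b ^+ 2 * z + (1 - z + b) * (P - b * z)
     + (P - b * z) ^+ 2 / v) <= 1 - 2 * q ^+ 2 + q ^+ 3.
Proof.
move=> hq hz hb; rewrite -subr_ge0; set p := P - b * z.
have z0 : 0 < z by clear -hz; lra.
have v0 : 0 < v by clear -hz; lra.
have hv : v <= 37/46 - z by rewrite /v; clear -hb; lra.
have hz' : z <= 37/92 by clear -hv hz; lra.
have -> : 1 - 2 * q ^+ 2 + q ^+ 3 -
  ((1 - z) ^+ 3 + 2 * (1 - z) * P + (b * z ^+ 2 + b ^+ 2 * z + (1 - z + b) * p
     + p ^+ 2 / v)) =
  ((q - z) ^+ 2 * (2 * z ^+ 2 - (q - z) ^+ 2) - z ^+ 2 * v * (v - z)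
    + (v - z) / v * (2 * p - z * v) ^+ 2) / (4 * z).
  rewrite /p /P /v; field; rewrite !gt_eqF //.
apply: divr_ge0; last by clear -z0; lra.
apply: addr_ge0; last first.
  rewrite mulr_ge0 ?sqr_ge0 // divr_ge0 //; last exact: ltW.
  by clear -hz; lra.
have h1 : z ^+ 2 * v * (v - z) <= z ^+ 2 * ((37/46 - z) * (37/46 - 2 * z)).
  rewrite -mulrA ler_wpM2l ?sqr_ge0 // ler_pM //; clear -v0 hv hz; lra.
(* The map [Y * (2 * z ^+ 2 - Y)] increases up to [Y = z ^+ 2], so [q] may be lowered to [25/46]. *)
have h2 : 0 <= ((q - z) ^+ 2 - (25/46 - z) ^+ 2)
   * (2 * z ^+ 2 - (q - z) ^+ 2 - (25/46 - z) ^+ 2).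
  have h3 : (25/46 - z) ^+ 2 <= (q - z) ^+ 2.
    by rewrite lerXn2r // ?nnegrE; clear -hq hz'; lra.
  have h4 : (q - z) ^+ 2 <= z ^+ 2.
    by rewrite lerXn2r // ?nnegrE; clear -hq hz hz'; lra.
  by rewrite mulr_ge0; clear -h3 h4; lra.
have h3 : z ^+ 2 * ((37/46 - z) * (37/46 - 2 * z)) <=
  (25/46 - z) ^+ 2 * (2 * z ^+ 2 - (25/46 - z) ^+ 2).
  (* Centring at the left end [15/46] of the range of [z] makes every term visibly nonnegative for
     [0 <= y <= 7/2]. *)
  set y := 46 * z - 15; have -> : z = (15 + y) / 46 by rewrite /y; field.
  have y0 : 0 <= y <= 7/2 by rewrite /y; clear -hz hz'; lra.
  rewrite -subr_ge0.
  have -> : (25 / 46 - (15 + y) / 46) ^+ 2 * (2 * ((15 + y) / 46) ^+ 2 -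
     (25 / 46 - (15 + y) / 46) ^+ 2) - ((15 + y) / 46) ^+ 2 *
     ((37 / 46 - (15 + y) / 46) * (37 / 46 - 2 * ((15 + y) / 46))) =
     (350 + y * (7855 - 224 * y) + y ^+ 3 * (51 - y)) / 46 ^+ 4 by field.
  have y0' : 0 <= y by clear -y0; lra.
  have y3 : 0 <= y ^+ 3 by rewrite exprn_ge0.
  apply: divr_ge0; last by apply: exprn_ge0.
  apply: addr_ge0; first apply: addr_ge0 => //.
    by rewrite mulr_ge0; clear -y0; lra.
  by rewrite mulr_ge0 ?exprn_ge0 //; clear -y0; lra.
by clear -h1 h2 h3; lra.
Qed.

(** Here the layer has width [t]. The gap vanishes at [t = s]; in its cofactor the main term
    [4 * a * s * (s - a)] outweighs the corrections, because [s - t <= 1/14]. *)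
Lemma small_clique_le_quasi_clique a s t (P := (s ^+ 2 + 2 * a * s - t ^+ 2) / 2) :
  33/100 <= a <= 2/5 -> 31/35 <= s + a -> 16/31 <= s <= 4/7 -> 1/2 <= t <= s ->
  t ^+ 3 + 2 * t * P + P * (t + P / t) <= s ^+ 3 + 3 * a * s ^+ 2 + a ^+ 2 * s.
Proof.
move=> ha hc hs ht; rewrite -subr_ge0.
have t0 : 0 < t by clear -ht; lra.
have hd : 0 <= s - t <= s - 1/2 by clear -ht; lra.
have -> : s ^+ 3 + 3 * a * s ^+ 2 + a ^+ 2 * s -
  (t ^+ 3 + 2 * t * P + P * (t + P / t)) =
  (s - t) * (s * (4 * a * (s - a) - (s - t) * (8 * a - 2 * s))
     - 4 * s * (s - t) ^+ 2 + (s - t) ^+ 3) / (4 * t).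
  by rewrite /P; field; rewrite gt_eqF.
apply: divr_ge0; last by clear -t0; lra.
apply: mulr_ge0; first by clear -hd; lra.
set d := s - t in hd *.
have h1 : d * (8 * a - 2 * s) <= (s - 1/2) * (8 * a - 2 * s).
  by rewrite ler_wpM2r //; clear -ha hs hd; lra.
have h2 : 1/25 <= 4 * a * (s - a) - (s - 1/2) * (8 * a - 2 * s).
  by clear -ha hs hc; nra.
have h3 : d ^+ 2 <= (1/14) ^+ 2.
  by rewrite lerXn2r // ?nnegrE; clear -hd hs; lra.
have h4 : 0 <= d ^+ 3 by rewrite exprn_ge0 //; clear -hd; lra.
have h5 : s * (1/25 - 4 * (1/14) ^+ 2) <=
   s * (4 * a * (s - a) - d * (8 * a - 2 * s) - 4 * d ^+ 2).
  by rewrite ler_wpM2l //; clear -hs h1 h2 h3; lra.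
by clear -h4 h5 hs; lra.
Qed.

(** This covers [t - b <= a], where the layer has width [a]. The gap vanishes at [t = s], and its
    cofactor is at least [s * (s - a) - (t - s) / 2]. *)
Lemma one_level_le_quasi_clique a b s t (P := (s ^+ 2 + 2 * a * s - t ^+ 2) / 2) :
  33/100 <= a <= 2/5 -> b <= 1/5 -> 16/31 <= s -> s <= t <= a + b ->
  t ^+ 3 + 2 * t * P + P * (a + P / a) <= s ^+ 3 + 3 * a * s ^+ 2 + a ^+ 2 * s.
Proof.
move=> ha hb hs ht; rewrite -subr_ge0.
have a0 : 0 < a by clear -ha; lra.
have hd : 0 <= t - s <= 3/5 - 16/31 by clear -ht hs ha hb; lra.
have -> : s ^+ 3 + 3 * a * s ^+ 2 + a ^+ 2 * s -
  (t ^+ 3 + 2 * t * P + P * (a + P / a)) =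
  (t - s) * (s * (s - a) + (t - s) * (s + a / 2 - (s + (t - s) / 2) ^+ 2 / a)).
  by rewrite /P; field; rewrite gt_eqF.
set d := t - s in hd *.
apply: mulr_ge0; first by clear -hd; lra.
have h1 : (s + d / 2) ^+ 2 / a <= 9/10.
  rewrite ler_pdivrMr //.
  have h2 : (s + d / 2) ^+ 2 <= (a + 1/5) ^+ 2.
    by rewrite lerXn2r // ?nnegrE /d; clear -ht hs hb a0; lra.
  have h3 : 0 <= (a - 1/10) * (2/5 - a) by rewrite mulr_ge0; clear -ha; lra.
  by clear -h2 h3; lra.
have h2 : 16/31 * (16/31 - 2/5) <= s * (s - a) by rewrite ler_pM //; clear -hs ha; lra.
have h3 : d * (- 1/2) <= d * (s + a / 2 - (s + d / 2) ^+ 2 / a).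
  by rewrite ler_wpM2l //; clear -hd h1 hs ha; lra.
by clear -h2 h3 hd; lra.
Qed.

(** The numerical core of the next comparison, with [d = t - s]: [18/23] is [4 * b] at [b = 9/46],
    [31/35 + d/2] is a lower bound for [a + s + d/2], and [27/10] bounds its square divided by
    [t - b]. *)
Lemma two_level_le_quasi_clique_aux a s d : 33/100 <= a -> 16/31 <= s <= 4/7 ->
    31/35 <= s + a -> 0 <= d <= 1 - a - s ->
  4 * a * s * (s - a) + d * (8 * a * s - 2 * s ^+ 2) - 4 * s * d ^+ 2 <=
  18/23 * ((31/35 + d/2) * (s + d) - 27/10 * d).
Proof.
move=> ha hs hc hd.
have s0 : 0 <= s by clear -hs; lra.
have d0 : 0 <= d by clear -hd; lra.
have hd' : d <= 4/35 by clear -hd hc; lra.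
have hda : a <= 1 - s - d by clear -hd; lra.
(* The product [a * (s - a)] is bounded by its value at [a = 31/35 - s], the smallest [a] allowed by
   [hc]. *)
have h1 : 4 * a * s * (s - a) <= 4 * s * ((31/35 - s) * (2 * s - 31/35)).
  have -> : 4 * a * s * (s - a) = 4 * s * (a * (s - a)) by ring.
  rewrite ler_wpM2l //; first by clear -s0; lra.
  have h : 0 <= (a + s - 31/35) * (a + 31/35 - 2 * s).
    by rewrite mulr_ge0; clear -hc hs ha; lra.
  by clear -h; lra.
have h2 : 4 * s * ((31/35 - s) * (2 * s - 31/35)) <= 14/125 + 3/2 * (s - 16/31).
  set x := s - 16/31; have -> : s = x + 16/31 by rewrite /x; ring.
  have x0 : 0 <= x by rewrite /x; clear -hs; lra.
  have := exprn_ge0 2 x0; have := exprn_ge0 3 x0; clear -x0; lra.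
have h3 : d * (8 * a * s - 2 * s ^+ 2) <= d * (8 * s * (1 - s - d) - 2 * s ^+ 2).
  rewrite ler_wpM2l // lerB // [8 * a * s]mulrAC ler_wpM2l //.
  by clear -s0; lra.
have h4 : d * (71/50 + 761/100 * s - 10 * s ^+ 2) - d ^+ 2 * (12 * s + 39/100)
    <= 9/13 * s - 14/125 - 3/2 * (s - 16/31).
  clear -hs d0 hd'.
  have h5 : 0 <= (4/35 - d) * ((71/50 + 761/100 * s - 10 * s ^+ 2)
                               - (d + 4/35) * (12 * s + 39/100)).
    have h1 : (d + 4/35) * (12 * s + 39/100) <= 8/35 * (12 * s + 39/100).
      by rewrite ler_wpM2r //; lra.
    have h2 : s ^+ 2 <= 4/7 * s by rewrite expr2 ler_wpM2r //; clear -hs; lra.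
    by rewrite mulr_ge0 //; first (by clear -hd'; lra); clear -h1 h2 hs; lra.
  have h6 : 4/35 * (71/50 + 761/100 * s - 10 * s ^+ 2)
            - (4/35) ^+ 2 * (12 * s + 39/100)
    <= 9/13 * s - 14/125 - 3/2 * (s - 16/31).
    have h : 0 <= (s - 16/31) * (4/7 - s) by rewrite mulr_ge0; clear -hs; lra.
    by clear -h hs; nra.
  by clear -h5 h6; lra.
have h5 : 0 <= d * s by rewrite mulr_ge0.
have h6 : 0 <= d ^+ 2 by rewrite sqr_ge0.
by clear -h1 h2 h3 h4 h5 h6 s0 d0; lra.
Qed.

(** The two-layer estimate at its left end [u = a]. With [d = t - s] and [c = a + s + d / 2] one has
    [t * a - P = c * d], which exhibits the factor [d] of the gap; in the cofactor, the part
    multiplied by [b] is large enough already for [b = 9/46]. *)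
Lemma two_level_le_quasi_clique a b s t (P := (s ^+ 2 + 2 * a * s - t ^+ 2) / 2) :
  33/100 <= a -> 9/46 <= b <= 1/5 -> 17/25 <= s ^+ 2 + 2 * a * s ->
  31/35 <= s + a <= 14/15 -> 16/31 <= s <= 4/7 ->
  s <= t <= 1 - a -> a <= t - b ->
  t ^+ 3 + 2 * t * P + (b * a ^+ 2 + b ^+ 2 * a + (t + b) * (P - b * a)
     + (P - b * a) ^+ 2 / (t - b)) <= s ^+ 3 + 3 * a * s ^+ 2 + a ^+ 2 * s.
Proof.
move=> ha hb hr hc hs ht hab; rewrite -subr_ge0.
(* Either [a] is at least [9/26], or [hr] forces [s >= 71/130], and [b <= 1/5]. *)
have htb : 9/26 <= t - b.
  have [|ha'] := leP (9/26) a; first by clear -hab; lra.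
  have : 71/130 <= s by clear -hr ha' ha hs; nra.
  by clear -hb ht; lra.
have t0 : 0 < t by clear -ht hs; lra.
have tb0 : 0 < t - b by clear -htb; lra.
have hd : 0 <= t - s <= 1 - a - s by clear -ht; lra.
have hc1 : 31/35 <= s + a by clear -hc; lra.
have := two_level_le_quasi_clique_aux ha hs hc1 hd.
have td : t = s + (t - s) by ring.
set d := t - s in hd td *; set c := a + s + d / 2.
have -> : s ^+ 3 + 3 * a * s ^+ 2 + a ^+ 2 * s -
  (t ^+ 3 + 2 * t * P + (b * a ^+ 2 + b ^+ 2 * a + (t + b) * (P - b * a)
     + (P - b * a) ^+ 2 / (t - b))) =
  d * (4 * b * (c * t - d * c ^+ 2 / (t - b))
       - (4 * a * s * (s - a) + d * (8 * a * s - 2 * s ^+ 2)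
          - 4 * s * d ^+ 2 - d ^+ 3)) / (4 * t).
  by rewrite /c /d /P; field; rewrite !gt_eqF //.
move=> aux.
have d0 : 0 <= d by clear -hd; lra.
have hc' : 31/35 + d/2 <= c <= 29/30 by rewrite /c; clear -hc hd; lra.
have hy : d * c ^+ 2 / (t - b) <= 27/10 * d.
  rewrite ler_pdivrMr // mulrAC [X in _ <= X]mulrC ler_wpM2l //.
  have : c ^+ 2 <= (29/30) ^+ 2 by rewrite lerXn2r // ?nnegrE; clear -d0 hc'; lra.
  by clear -htb; lra.
have h1 : (31/35 + d/2) * (s + d) - 27/10 * d <= c * t - d * c ^+ 2 / (t - b).
  rewrite lerB // -td ler_wpM2r //; first exact: ltW.
  by clear -hc'; lra.
have h3 : 0 <= d ^+ 3 by rewrite exprn_ge0.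
have h0 : 0 <= (31/35 + d/2) * (s + d) - 27/10 * d.
  by clear -hd d0 hs hc; nra.
set Y := c * t - _ in h1 *.
have h2 : 18/23 * ((31/35 + d/2) * (s + d) - 27/10 * d) <= 4 * b * Y.
  by rewrite ler_pM //; clear -hb; lra.
apply: divr_ge0; last by clear -t0; lra.
by apply: mulr_ge0 => //; clear -aux h2 h3; lra.
Qed.

(** * Convexity and the range of the parameters *)

(** A convex quadratic lies below its chord; the end values get the weights [v - w] and [w - u]. *)
Lemma quadratic_le0_between (c0 c1 c2 u v w : R) : 0 <= c2 -> u <= w <= v ->
  c0 + c1 * u + c2 * u ^+ 2 <= 0 -> c0 + c1 * v + c2 * v ^+ 2 <= 0 ->
  c0 + c1 * w + c2 * w ^+ 2 <= 0.
Proof.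
move=> hc /andP[uw wv] hu hv; have [uv|vu] := ltP u v; last first.
  by have -> : w = u by apply/le_anti; rewrite uw (le_trans wv).
have h1 : 0 <= c2 * ((w - u) * (v - w)).
  by rewrite mulr_ge0 // mulr_ge0 ?subr_ge0.
have h2 : (v - w) * (c0 + c1 * u + c2 * u ^+ 2) <= 0.
  by rewrite mulr_ge0_le0 // subr_ge0.
have h3 : (w - u) * (c0 + c1 * v + c2 * v ^+ 2) <= 0.
  by rewrite mulr_ge0_le0 // subr_ge0.
have h4 : 0 <= (v - u) * (c2 * ((w - u) * (v - w))).
  by rewrite mulr_ge0 // subr_ge0 ltW.
rewrite -(ler_pM2l (_ : 0 < v - u)) ?subr_gt0 // mulr0.
by clear -h2 h3 h4; lra.
Qed.

(** The ranges follow from the monotonicity of [s ^+ 2 + 2 * a * s] and from completing the square.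
    The last inequality is the one that lets edges between I and O be absorbed when [t > s]. *)
Lemma quasi_clique_root_range a s : 33/100 <= a <= 2/5 -> 0 <= s ->
  17/25 <= s ^+ 2 + 2 * a * s <= 26/37 ->
  [/\ 16/31 <= s <= 4/7, 31/35 <= s + a <= 14/15 & 16/5 + a <= 4 * (s + a)].
Proof.
move=> ha s0 hr.
have hc : (s + a) ^+ 2 = s ^+ 2 + 2 * a * s + a ^+ 2 by ring.
have a0 : 0 <= a by clear -ha; lra.
split.
- apply/andP; split; rewrite leNgt; apply/negP => hs.
    have h1 : a * s <= 2/5 * (16/31) by rewrite ler_pM //; clear -ha hs; lra.
    have h2 : s ^+ 2 <= (16/31) ^+ 2 by rewrite lerXn2r // ?nnegrE; clear -hs; lra.
    by clear -h1 h2 hr; lra.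
  have h1 : 33/100 * (4/7) <= a * s by rewrite ler_pM //; clear -ha hs; lra.
  have h2 : (4/7) ^+ 2 <= s ^+ 2 by rewrite lerXn2r // ?nnegrE; clear -hs; lra.
  by clear -h1 h2 hr; lra.
- have h1 : (33/100) ^+ 2 <= a ^+ 2 by rewrite lerXn2r // ?nnegrE; clear -ha; lra.
  have h2 : a ^+ 2 <= (2/5) ^+ 2 by rewrite lerXn2r // ?nnegrE; clear -ha; lra.
  by apply/andP; split; rewrite -(@ler_pXn2r _ 2) ?nnegrE //;
    first [clear -a0 s0; lra | clear -h1 h2 hc hr; lra].
- have h : 16/5 + a <= 4 * (s + a) = (4/5 + a / 4 <= s + a).
    by apply/idP/idP => h; clear -h; lra.
  rewrite h -(@ler_pXn2r _ 2) ?nnegrE //; try by clear -a0 s0; lra.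
  have h1 : 0 <= (a - 33/100) * (a + 33/100 - 32/75).
    by rewrite mulr_ge0; clear -ha; lra.
  by clear -h1 hc hr; lra.
Qed.

(* Turning x edges of weight at most M into edges counted by p does not decrease the
   bound. *)
Lemma absorb_cross_edges (L p x M : R) : 0 < L -> x * M * L <= x * (L ^+ 2 + 2 * p + x) ->
  p * (L + p / L) + x * M <= (p + x) * (L + (p + x) / L).
Proof.
move=> L0 h.
rewrite -subr_ge0.
have -> : (p + x) * (L + (p + x) / L) - (p * (L + p / L) + x * M) =
  (x * (L ^+ 2 + 2 * p + x) - x * M * L) / L by field; rewrite gt_eqF.
by rewrite divr_ge0 ?subr_ge0 // ltW.
Qed.

(** * The whole bound, according to the size of the clique *)

(** The edges between I and O are absorbed into the layer of width [z], which reduces the claim to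
    [columns_le_quasi_star]. The crude weight bound suffices below [t = 3/10]; from there on the
    second one is used. *)
Lemma total_le_small q r t a b p x M m (z := 1 - t) (om := 1 - a - t) :
  33/100 <= a <= 2/5 -> b <= 1/5 -> 17/25 <= r <= 26/37 ->
  0 <= q -> q ^+ 2 = 1 - r -> 0 <= t <= 1/2 -> 0 <= p -> 0 <= x -> t ^+ 2 + 2 * p + 2 * x = r ->
  0 <= m -> m <= a -> 0 <= om -> x <= m * om -> M <= 4 * t + om + m ->
  (3/10 <= t -> M <= 2 * t + om + 2 * (1 - a + b - t - m)) ->
  t ^+ 3 + 2 * t * p + p * (z + p / z) + x * M <= 1 - 2 * q ^+ 2 + q ^+ 3.
Proof.
move=> ha hb hr q0 hq ht p0 x0 hp m0 hm om0 hx hM1 hM2.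
have z0 : 1/2 <= z by rewrite /z; clear -ht; lra.
have hV : q ^+ 2 <= z ^+ 2 + 2 * q * z.
  have h : q ^+ 2 <= (4/7) ^+ 2 by rewrite hq; clear -hr; lra.
  have h0 : q <= 4/7 by rewrite -(@ler_pXn2r _ 2) ?nnegrE //; clear; lra.
  have h1 : (1/2) ^+ 2 <= z ^+ 2 by rewrite lerXn2r // ?nnegrE; clear -z0; lra.
  have h2 : q * (1/2) <= q * z by rewrite ler_wpM2l //.
  have h3 : q * q <= q * (4/7) by rewrite ler_wpM2l //.
  by rewrite expr2; clear -h1 h2 h3 q0; lra.
have z1 : 0 < z by clear -z0; lra.
have := columns_le_quasi_star z1 hV.
have -> : 1 - z = t by rewrite /z; ring.
have -> : (1 - q ^+ 2 - t ^+ 2) / 2 = p + x by rewrite hq -hp; field.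
suff hs : x * (M - 2 * t) * z <= x * (z ^+ 2 + 2 * p + x).
  have := absorb_cross_edges z1 hs; clear; lra.
rewrite -mulrA ler_wpM2l //.
have [t3|t3] := leP (3/10) t.
  have h1 : (M - 2 * t) * z <= (om + 2 * (1 - a + b - t - m)) * z.
    by rewrite (ler_wpM2r (ltW z1)); have := hM2 t3; clear; lra.
  have h2 : m * om <= m * z by rewrite ler_wpM2l /om /z //; clear -ha hm; lra.
  have h3 : 0 <= m * z by rewrite mulr_ge0 // ltW.
  (* The constant [241/100] is [3 * (1 - a) + 2 * b] at [a = 33/100] and [b = 1/5]. *)
  have h4 : (3 * (1 - a) + 2 * b - 3 * t) * z <= (241/100 - 3 * t) * z.
    by rewrite (ler_wpM2r (ltW z1)); clear -ha hb; lra.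
  have h5 : 0 <= (t - 3/10) * (1/2 - t) by rewrite mulr_ge0; clear -t3 ht; lra.
  by move: h1 h2 h3 h4 hx; rewrite /om /z; clear -h5 hp hr t3 ht; lra.
have h1 : (M - 2 * t) * z <= (2 * t + om + a) * z.
  by rewrite (ler_wpM2r (ltW z1)); clear -hM1 hm; lra.
have h2 : m * om <= a * om by rewrite ler_wpM2r //; clear -hm; lra.
have h3 : a * om <= 17/100 - 4/10 * (t - 3/10).
  by rewrite /om; clear -ha ht t3; nra.
by move: h1 h2 h3 hx; rewrite /om /z; clear -hp hr t3 ht; nra.
Qed.

(** The same absorption with width [t], reducing to [small_clique_le_quasi_clique]. *)
Lemma total_le_medium r t a b s p x M m (om := 1 - a - t) :
  33/100 <= a <= 2/5 -> b <= 1/5 -> 17/25 <= r <= 26/37 ->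
  0 <= s -> s ^+ 2 + 2 * a * s = r -> 1/2 <= t <= s -> 0 <= p -> 0 <= x ->
  t ^+ 2 + 2 * p + 2 * x = r ->
  0 <= m -> m <= a -> 0 <= om -> x <= m * om ->
  M <= 2 * t + om + 2 * (1 - a + b - t - m) ->
  t ^+ 3 + 2 * t * p + p * (t + p / t) + x * M <= s ^+ 3 + 3 * a * s ^+ 2 + a ^+ 2 * s.
Proof.
move=> ha hb hr s0 hsr ht p0 x0 hp m0 hm om0 hx hM.
have t1 : 0 < t by clear -ht; lra.
have [|hs /andP[hc _] _] := quasi_clique_root_range ha s0; first by rewrite hsr.
have := small_clique_le_quasi_clique ha hc hs ht.
have -> : (s ^+ 2 + 2 * a * s - t ^+ 2) / 2 = p + x by rewrite hsr -hp; field.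
suff hx' : x * (M - 2 * t) * t <= x * (t ^+ 2 + 2 * p + x).
  have := absorb_cross_edges t1 hx'; clear; lra.
rewrite -mulrA ler_wpM2l //.
have h1 : (M - 2 * t) * t <= (om + 2 * (1 - a + b - t - m)) * t.
  by rewrite (ler_wpM2r (ltW t1)); clear -hM; lra.
have h2 : m * om <= m * t by rewrite ler_wpM2l /om //; clear -ha hm ht; lra.
have h3 : 0 <= m * t by rewrite mulr_ge0 // ltW.
have h4 : (3 * (1 - a) + 2 * b - 3 * t) * t <= (241/100 - 3 * t) * t.
  by rewrite (ler_wpM2r (ltW t1)); clear -ha hb; lra.
have h5 : t ^+ 2 >= 1/2 * t by rewrite expr2 ler_wpM2r //; clear -ht; lra.
by move: h1 h2 h3 h4 hx; rewrite /om; clear -h5 hp hr ht hs; lra.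
Qed.

(** Multiplied by the positive width, the inequality becomes that of a convex quadratic. *)
Lemma one_level_between P K T u w v : 0 < u -> u <= w <= v -> K + P * (u + P / u) <= T ->
  K + P * (v + P / v) <= T -> 0 <= P -> K + P * (w + P / w) <= T.
Proof.
move=> u0 uwv hu hv P0.
have w0 : 0 < w by case/andP: uwv => uw _; exact: lt_le_trans uw.
have v0 : 0 < v by case/andP: uwv => _ wv; exact: lt_le_trans wv.
have E y : 0 < y -> (K + P * (y + P / y) <= T) = (P ^+ 2 + (K - T) * y + P * y ^+ 2 <= 0).
  move=> y0; rewrite -subr_le0 -(pmulr_lle0 _ y0).
  by congr (_ <= 0); field; rewrite gt_eqF.
move: hu hv; rewrite !E // => hu hv.
exact: quadratic_le0_between hu hv.
Qed.

(* The bound is convex in u on either side of v, where its two expressions agree, so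
   the end points u = a and u = 1 - t suffice. *)
Lemma two_level_le_max q r a b s t P u T (v := t - b) :
  33/100 <= a <= 2/5 -> 9/46 <= b <= 1/5 -> 17/25 <= r <= 26/37 ->
  0 <= q -> q ^+ 2 = 1 - r -> 0 <= s -> s ^+ 2 + 2 * a * s = r ->
  s <= t <= 1 - a -> t ^+ 2 + 2 * P = r -> a <= u <= 1 - t -> b * u <= P ->
  1 - 2 * q ^+ 2 + q ^+ 3 <= T -> s ^+ 3 + 3 * a * s ^+ 2 + a ^+ 2 * s <= T ->
  t ^+ 3 + 2 * t * P + (b * u ^+ 2 + b ^+ 2 * u + 2 * b * (P - b * u)
   + (P - b * u) * (Num.max v u + (P - b * u) / Num.max v u)) <= T.
Proof.
move=> ha hb hr q0 hq s0 hsr ht hP hu hbu hQS hQC.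
have [|hs hc _] := quasi_clique_root_range ha s0; first by rewrite hsr.
have v0 : 0 < v by rewrite /v; clear -ht hs hb; lra.
have a0 : 0 < a by clear -ha; lra.
have z0 : 0 < 1 - t by clear -ht a0; lra.
have u0 : 0 < u by clear -hu a0; lra.
have P0 : 0 <= P by rewrite (le_trans _ hbu) // mulr_ge0 //; clear -hb u0; lra.
have hP' : (s ^+ 2 + 2 * a * s - t ^+ 2) / 2 = P by rewrite hsr -hP; field.
have hP'' : (1 - q ^+ 2 - t ^+ 2) / 2 = P by rewrite hq -hP; field.
have q1 : 25/46 <= q <= 4/7.
  by apply/andP; split; rewrite -(@ler_pXn2r _ 2) ?nnegrE //; clear -hq hr q0; lra.
have abP : b * a <= P.
  by rewrite (le_trans _ hbu) // ler_wpM2l; clear -hb hu; lra.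
have Pta : P <= t * a.
  have h : 0 <= (t - s) * (t + s + 2 * a) by rewrite mulr_ge0; clear -ht s0 a0; lra.
  by rewrite -hP'; clear -h; lra.
(* In these names [A] stands for the expression valid for [u <= v] and [B] for the one valid for
   [u >= v]; the second letter is the point of evaluation, [z] being [1 - t]. *)
have Aa : a <= v -> t ^+ 3 + 2 * t * P + (b * a ^+ 2 + b ^+ 2 * a + (t + b) * (P - b * a)
     + (P - b * a) ^+ 2 / v) <= T.
  move=> av; apply: le_trans hQC.
  have ha1 : 33/100 <= a by clear -ha; lra.
  have hr1 : 17 / 25 <= s ^+ 2 + 2 * a * s by rewrite hsr; clear -hr; lra.
  by have := two_level_le_quasi_clique ha1 hb hr1 hc hs ht av; rewrite hP'.
have Bz : t ^+ 3 + 2 * t * P + P * (1 - t + P / (1 - t)) <= T.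
  apply: le_trans hQS.
  have hV : q ^+ 2 <= (1 - t) ^+ 2 + 2 * q * (1 - t).
    have h1 : q * q <= q * (4/7) by rewrite ler_wpM2l //; clear -q1; lra.
    have h3 : q * (33/100) <= q * (1 - t) by rewrite ler_wpM2l //; clear -ht ha; lra.
    have h4 : (33/100) ^+ 2 <= (1 - t) ^+ 2.
      by rewrite lerXn2r // ?nnegrE; clear -ht ha; lra.
    have h5 : q * q <= 4/7 * (4/7) by rewrite ler_pM //; clear -q1; lra.
    by rewrite [_ ^+ 2]expr2; clear -h1 h3 h4 h5 q1; nra.
  have := columns_le_quasi_star z0 hV.
  by have -> : 1 - (1 - t) = t by [ring]; rewrite hP''.
have Ba : t ^+ 3 + 2 * t * P + P * (a + P / a) <= T.
  (* If [a <= v], the one-layer value at [a] is at most the two-layer value, so [Aa] suffices. *)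
  have [av|va] := leP a v.
    apply: le_trans (Aa av); rewrite lerD2l -subr_ge0.
    have -> : b * a ^+ 2 + b ^+ 2 * a + (t + b) * (P - b * a) + (P - b * a) ^+ 2 / v
      - P * (a + P / a) =
      (P - b * a) * (v - a) * (t * a - P) / (v * a).
      by rewrite /v; field; rewrite !gt_eqF.
    apply: divr_ge0; last by rewrite ltW // mulr_gt0.
    by rewrite !mulr_ge0 ?subr_ge0.
  apply: le_trans hQC.
  have hb1 : b <= 1/5 by clear -hb; lra.
  have hs1 : 16/31 <= s by clear -hs; lra.
  have ht1 : s <= t <= a + b by move: va; rewrite /v; clear -ht; lra.
  by have := one_level_le_quasi_clique ha hb1 hs1 ht1; rewrite hP'.
have Bw w : a <= w <= 1 - t -> t ^+ 3 + 2 * t * P + P * (w + P / w) <= T.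
  by move=> hw; apply: one_level_between Ba Bz P0.
have [uv|vu] := leP u v; last first.
  have -> : b * u ^+ 2 + b ^+ 2 * u + 2 * b * (P - b * u) +
     (P - b * u) * (u + (P - b * u) / u) = P * (u + P / u).
    by field; rewrite gt_eqF.
  exact: Bw.
have av : a <= v by rewrite (le_trans _ uv) //; clear -hu; lra.
have EA w : (t ^+ 3 + 2 * t * P + (b * w ^+ 2 + b ^+ 2 * w + (t + b) * (P - b * w)
     + (P - b * w) ^+ 2 / v) <= T) =
    (t ^+ 3 + 2 * t * P + (t + b) * P + P ^+ 2 / v - T
     + (b ^+ 2 - (t + b) * b - 2 * P * b / v) * w + (b + b ^+ 2 / v) * w ^+ 2 <= 0).
  by rewrite -subr_le0; congr (_ <= 0); field; rewrite gt_eqF.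
have -> : b * u ^+ 2 + b ^+ 2 * u + 2 * b * (P - b * u) +
     (P - b * u) * (v + (P - b * u) / v) =
   b * u ^+ 2 + b ^+ 2 * u + (t + b) * (P - b * u) + (P - b * u) ^+ 2 / v.
  by rewrite /v; field; rewrite gt_eqF.
have b0 : 0 <= b by clear -hb; lra.
have c2 : 0 <= b + b ^+ 2 / v.
  by rewrite addr_ge0 // divr_ge0 ?sqr_ge0 // ltW.
move: (Aa av); rewrite !EA => Aa'.
have [zv|vz] := leP (1 - t) v.
  apply: (quadratic_le0_between c2 hu Aa').
  rewrite -EA; apply: le_trans hQS.
  have hz : 15/46 <= 1 - t <= 1 - (1 - t) - b.
    by move: zv; rewrite /v; clear -ht ha; lra.
  have hb1 : 9/46 <= b by clear -hb; lra.
  have := two_level_le_quasi_star q1 hz hb1.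
  by have -> : 1 - (1 - t) = t by [ring]; rewrite hP''.
have auv : a <= u <= v by rewrite uv andbT; clear -hu; lra.
apply: (quadratic_le0_between c2 auv Aa').
rewrite -EA; apply: le_trans (Bw v _); last by rewrite av ltW.
rewrite lerD2l le_eqVlt; apply/orP; left; apply/eqP.
by rewrite /v; field; rewrite gt_eqF.
Qed.

Lemma mul_add_div_le p P L : 0 < L -> 0 <= p -> p <= P ->
  p * (L + p / L) <= P * (L + P / L).
Proof.
move=> L0 p0 pP; apply: ler_pM => //.
  by rewrite addr_ge0 ?divr_ge0 // ltW.
by rewrite lerD2l ler_pM2r ?invr_gt0.
Qed.

(* p n^2 edges join C to its complement and x n^2 edges join I to O; S bounds the
   sums of squares of the numbers of edges across C at both ends, and M bounds the
   weight of an edge between I and O. *)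
Lemma total_le q r a b s t p x S M T (om := 1 - a - t) :
  33/100 <= a <= 2/5 -> 9/46 <= b <= 1/5 -> 17/25 <= r <= 26/37 ->
  0 <= q -> q ^+ 2 = 1 - r -> 0 <= s -> s ^+ 2 + 2 * a * s = r ->
  0 <= t -> 0 <= om -> 0 <= p -> 0 <= x -> t ^+ 2 + 2 * p + 2 * x <= r ->
  (forall L, t <= L -> 1 - t <= L -> S <= p * (L + p / L)) ->
  (om <= b -> b < t -> exists u, [/\ a <= u <= 1 - t, b * u <= p &
    S <= b * u ^+ 2 + b ^+ 2 * u + 2 * b * (p - b * u)
     + (p - b * u) * (Num.max (t - b) u + (p - b * u) / Num.max (t - b) u)]) ->
  x = 0 \/ (exists m, [/\ 0 <= m <= a, x <= m * om, M <= 4 * t + om + m &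
    b <= t -> M <= 2 * t + om + 2 * (1 - a + b - t - m)]) ->
  1 - 2 * q ^+ 2 + q ^+ 3 <= T -> s ^+ 3 + 3 * a * s ^+ 2 + a ^+ 2 * s <= T ->
  t ^+ 3 + 2 * t * p + S + x * M <= T.
Proof.
move=> ha hb hr q0 hq s0 hsr t0 om0 p0 x0 hp hS1 hS2 hM hQS hQC.
have hb1 : b <= 1/5 by clear -hb; lra.
(* The case without edges between I and O is treated as [m = 0] with weight 0. *)
have {hM} [N [m [hxN [m0 hm] hx hM1 hM2]]] : exists N m, [/\ x * M = x * N,
   0 <= m /\ m <= a, x <= m * om, N <= 4 * t + om + m &
   b <= t -> N <= 2 * t + om + 2 * (1 - a + b - t - m)].
  case: hM => [->|[m [/andP[m0 hm] hx h1 h2]]]; last by exists M, m.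
  exists 0, 0; rewrite !mul0r; split=> //; first by split=> //; clear -ha; lra.
    by clear -t0 om0; lra.
  by move: om0; rewrite /om; clear -t0 hb ha => om0 _; lra.
rewrite hxN {hxN M}; set M := N in hM1 hM2 *.
(* Raising [p] to [P] turns the edge count [hp] into an equality and can only increase the
   bounds. *)
pose P := (r - t ^+ 2) / 2 - x.
have pP : p <= P by rewrite /P; clear -hp; lra.
have P0 : 0 <= P by rewrite (le_trans p0).
have hP : t ^+ 2 + 2 * P + 2 * x = r by rewrite /P; field.
have tp : 2 * t * p <= 2 * t * P by rewrite ler_wpM2l // mulr_ge0.
have t1 : t <= 1 - a by move: om0; rewrite /om; clear; lra.
have [th|ht] := leP t (1/2).
  have z0 : 0 < 1 - t by clear -th; lra.
  have ht : 0 <= t <= 1/2 by rewrite t0.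
  have h3 : 3/10 <= t -> M <= 2 * t + om + 2 * (1 - a + b - t - m).
    by move=> h; apply: hM2; clear -h hb; lra.
  have := total_le_small ha hb1 hr q0 hq ht P0 x0 hP m0 hm om0 hx hM1 h3.
  have h4 : t <= 1 - t by clear -th; lra.
  have := hS1 _ h4 (lexx _); have := mul_add_div_le z0 p0 pP.
  by clear -tp hQS; lra.
have h3 : M <= 2 * t + om + 2 * (1 - a + b - t - m).
  by apply: hM2; clear -ht hb; lra.
have [ts|st] := leP t s.
  have ht' : 1/2 <= t <= s by rewrite ts ltW.
  have t0' : 0 < t by clear -ht; lra.
  have := total_le_medium ha hb1 hr s0 hsr ht' P0 x0 hP m0 hm om0 hx h3.
  have h4 : 1 - t <= t by clear -ht; lra.
  have := hS1 _ (lexx _) h4; have := mul_add_div_le t0' p0 pP.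
  by clear -tp hQC; lra.
have [|hs hc hc4] := quasi_clique_root_range ha s0; first by rewrite hsr.
have bt : b < t by clear -ht hb; lra.
(* By [s < t] and [31/35 <= s + a], [om] is below [4/35]. *)
have omb : om <= b by rewrite /om; clear -st hc hb; lra.
have {hS2} [u [hu hbu hS]] := hS2 omb bt.
have hst : s <= t <= 1 - a by rewrite t1 ltW.
have hPx : t ^+ 2 + 2 * (P + x) = r by rewrite /P; field.
have hbu' : b * u <= P + x by clear -hbu pP x0; lra.
have := two_level_le_max ha hb hr q0 hq s0 hsr hst hPx hu hbu' hQS hQC.
set L := Num.max _ _ in hS *.
have hL : t - b <= L by rewrite /L le_max lexx.
have L0 : 0 < L by clear -hL bt; lra.
have p2 : 0 <= p - b * u by rewrite subr_ge0.
have pP2 : p - b * u <= P - b * u by rewrite lerB.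
have P2 : 0 <= P - b * u by rewrite (le_trans p2).
(* By [h3], [M - 2 * t - 2 * b <= 3 * om], and [3 * om <= t - b <= L] follows from [hc4], [s < t]
   and [b <= 1/5]. *)
have hN : x * (M - 2 * t - 2 * b) * L <= x * (L ^+ 2 + 2 * (P - b * u) + x).
  rewrite -mulrA ler_wpM2l //.
  have h4 : (M - 2 * t - 2 * b) * L <= L * L.
    rewrite ler_wpM2r ?(ltW L0) //.
    by move: h3; rewrite /om; clear -hL st hc4 hb m0; lra.
  by rewrite expr2; clear -h4 P2 x0; lra.
have := mul_add_div_le L0 p2 pP2; have := absorb_cross_edges L0 hN.
have -> : P - b * u + x = P + x - b * u by ring.
have bp : b * p <= b * P by rewrite ler_wpM2l //; clear -hb; lra.
by clear -hS tp bp; lra.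
Qed.

End Optimization.

(** The layers below and above [k] are both monotone functions of the argument, so each contributes
    its own minimum. *)
Lemma minr_truncate (R : realFieldType) (f g k : R) : Num.min f g =
  Num.min (Num.min f k) (Num.min g k) + Num.min (f - Num.min f k) (g - Num.min g k).
Proof.
by case: (leP f k) => h1; case: (leP g k) => h2; rewrite ?subrr;
  case: (leP f g) => h3; do ?[case: leP => ?]; lra.
Qed.

(** * Sums of minima *)

Section MinSums.
Variables (R : realFieldType) (T : finType) (J : {set T}).

(* L min(x_i, x_j) exceeds x_i x_j by at most the mean of x_i (L - x_i) and
   x_j (L - x_j), and by nothing if one of these vanishes. *)
Lemma sum_min_le (x : T -> R) (L : R) (p := \sum_(j in J) x j) :
  0 < L -> (forall j, j \in J -> 0 <= x j <= L) ->
  #|[set j in J | 0 < x j < L]|%:R <= L ->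
  \sum_(j in J) x j ^+ 2 + \sum_(i in J) \sum_(j in J) Num.min (x i) (x j)
    <= p * (L + p / L).
Proof.
move=> L0 hx hW.
(* On [J], [phi] vanishes outside [W], so only pairs inside [W] can have an excess. *)
set W := [set j in J | _] in hW; pose phi j := x j * (L - x j).
have phi0 j : j \in J -> 0 <= phi j.
  by move=> /hx /andP[h1 h2]; rewrite mulr_ge0 ?subr_ge0.
have minE i j : i \in J -> j \in J -> L * Num.min (x i) (x j) <=
    x i * x j + ((i \in W)%:R * (j \in W)%:R) * ((phi i + phi j) / 2).
  wlog : i j / x i <= x j => [h|ij] iJ jJ.
    case/orP: (le_total (x i) (x j)) => ij; first exact: h.
    rewrite minC [x i * _]mulrC [(i \in W)%:R * _]mulrC [phi i + _]addrC; exact: h.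
  rewrite (min_idPl ij).
  have [/andP[i0 iL] /andP[j0 jL]] := (hx _ iJ, hx _ jJ).
  have h1 : x i * (L - x j) <= phi i by rewrite ler_wpM2l // lerB.
  have h2 : x i * (L - x j) <= phi j by rewrite ler_wpM2r ?subr_ge0.
  rewrite !inE iJ jJ /=.
  have [/eqP xi0|xi0] := boolP (x i == 0); first by rewrite xi0 ltxx !mul0r mulr0 addr0.
  have [/eqP xjL|xjL] := boolP (x j == L).
    by rewrite xjL ltxx andbF mulr0 mul0r addr0 mulrC.
  have xip : 0 < x i by rewrite lt_def xi0.
  have xjl : x j < L by rewrite lt_neqAle xjL.
  rewrite xip xjl (le_lt_trans ij xjl) (lt_le_trans xip ij) /= !mul1r.
  by clear -h1 h2; lra.
have sumphi : \sum_(j in J) phi j = L * p - \sum_(j in J) x j ^+ 2.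
  rewrite /p mulr_sumr -sumrB; apply: eq_bigr => j _; rewrite /phi; ring.
(* Over the pairs in [W] the means add up to [#|W|] times the sum of [phi], and [#|W| <= L].
   Inserting [sumphi] then produces the squares with the right sign. *)
have key : L * \sum_(i in J) \sum_(j in J) Num.min (x i) (x j) <=
    p ^+ 2 + L * \sum_(j in J) phi j.
  apply: (@le_trans _ _ (\sum_(i in J) \sum_(j in J) (x i * x j +
     ((i \in W)%:R * (j \in W)%:R) * ((phi i + phi j) / 2)))).
    rewrite mulr_sumr; apply: ler_sum => i iJ; rewrite mulr_sumr.
    by apply: ler_sum => j jJ; exact: minE.
  have -> : \sum_(i in J) \sum_(j in J) (x i * x j +
     ((i \in W)%:R * (j \in W)%:R) * ((phi i + phi j) / 2)) =
     p ^+ 2 + #|W|%:R * \sum_(j in W) phi j.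
    under eq_bigr do rewrite big_split /=.
    rewrite big_split /=; congr (_ + _).
      by rewrite expr2 /p mulr_suml; apply: eq_bigr => i _; rewrite mulr_sumr.
    have WJ i : (i \in J) && (i \in W) = (i \in W) by rewrite !inE; case: (i \in J).
    have restr (g : T -> R) : \sum_(i in J) (i \in W)%:R * g i = \sum_(i in W) g i.
      rewrite -(eq_bigl _ _ WJ) big_mkcondr /=; apply: eq_bigr => i _.
      by case: (i \in W); rewrite ?mul1r ?mul0r.
    have -> : \sum_(i in J) \sum_(j in J) (i \in W)%:R * (j \in W)%:R *
         ((phi i + phi j) / 2) = \sum_(i in W) \sum_(j in W) (phi i + phi j) / 2.
      rewrite -restr; apply: eq_bigr => i _; rewrite -restr mulr_sumr.
      by apply: eq_bigr => j _; rewrite -!mulrA.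
    have -> : \sum_(i in W) \sum_(j in W) (phi i + phi j) / 2 =
        \sum_(i in W) (#|W|%:R * phi i / 2 + (\sum_(j in W) phi j) / 2).
      apply: eq_bigr => i _; rewrite -mulr_suml big_split /= sumr_const.
      by rewrite -mulrDl mulr_natl.
    rewrite big_split /= -mulr_suml -mulr_sumr sumr_const -mulr_natl; by field.
  rewrite lerD2l; apply: ler_pM => //.
    by apply: sumr_ge0 => j; rewrite inE => /andP[/phi0].
  rewrite [leRHS](bigID (fun j => j \in W)) /= -[leLHS]addr0 lerD //.
    rewrite le_eqVlt; apply/orP; left; apply/eqP; apply: eq_bigl => j.
    by rewrite !inE; case: (j \in J).
  by apply: sumr_ge0 => j /andP[/phi0].
rewrite sumphi in key.
rewrite -(ler_pM2l L0).
have -> : L * (p * (L + p / L)) = L * (L * p) + p ^+ 2 by field; rewrite gt_eqF.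
by clear -key; lra.
Qed.

Variables (I : {set T}) (f : T -> R) (K k : R).
Let p := \sum_(j in J) f j.
Let S := \sum_(j in J) f j ^+ 2 + \sum_(i in J) \sum_(j in J) Num.min (f i) (f j).

Hypothesis f_ge0 : forall j, j \in J -> 0 <= f j <= K.

Lemma sum_min_le_max L : 0 < L -> K <= L -> #|J|%:R <= L -> S <= p * (L + p / L).
Proof.
move=> L0 KL JL; apply: sum_min_le => //.
  by move=> j /f_ge0 /andP[-> fK]; rewrite (le_trans fK).
by rewrite (le_trans _ JL) // ler_nat subset_leq_card //; apply/subsetP=> j; rewrite inE => /andP[].
Qed.

(** Each layer is estimated by [sum_min_le]. In the lower one, truncated at [k], only indices
    outside [I] lie strictly between 0 and [k], so width [k] is allowed. In the upper one the values
    are at most [K - k], and every index with a positive value contributes [k] to [p1 = k * u], so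
    there are at most [u] of them. *)
Lemma sum_min_le_split : 0 < k -> k < K -> I \subset J ->
  (forall i, i \in I -> k <= f i) -> #|J :\: I|%:R <= k ->
  exists u, [/\ #|I|%:R <= u <= #|J|%:R, k * u <= p &
    S <= k * u ^+ 2 + k ^+ 2 * u + 2 * k * (p - k * u) +
     (p - k * u) * (Num.max (K - k) u + (p - k * u) / Num.max (K - k) u)].
Proof.
move=> k0 kK IJ fI hJI.
pose x j := Num.min (f j) k; pose y j := f j - x j.
have xle j : x j <= f j by rewrite ge_min lexx.
have xk j : x j <= k by rewrite ge_min lexx orbT.
have x0 j : j \in J -> 0 <= x j by move=> /f_ge0 /andP[f0 _]; rewrite le_min f0 ltW.
have y0 j : 0 <= y j by rewrite subr_ge0.
have xI j : j \in I -> x j = k by move=> /fI h; rewrite /x; apply/min_idPr.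
pose p1 := \sum_(j in J) x j; pose u := p1 / k.
have ku : k * u = p1 by rewrite /u mulrC divfK // gt_eqF.
have py : \sum_(j in J) y j = p - k * u by rewrite ku /p1 /p -sumrB.
have hx : \sum_(j in J) x j ^+ 2 + \sum_(i in J) \sum_(j in J) Num.min (x i) (x j)
    <= p1 * (k + p1 / k).
  apply: sum_min_le => //; first by move=> j jJ; rewrite x0 // xk.
  rewrite (le_trans _ hJI) // ler_nat subset_leq_card //; apply/subsetP=> j.
  rewrite !inE => /andP[jJ /andP[_ xjk]]; rewrite jJ andbT.
  by apply/negP => /xI xj; rewrite xj ltxx in xjk.
have u_lo : #|I|%:R <= u.
  rewrite ler_pdivlMr // mulr_natl -sumr_const /p1.
  rewrite [leRHS](big_setID I) /= (setIidPr IJ).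
  rewrite -[leLHS]addr0 lerD //.
    by rewrite le_eqVlt; apply/orP; left; apply/eqP/eq_bigr => i /xI.
  by apply: sumr_ge0 => j; rewrite inE => /andP[_ /x0].
have u_hi : u <= #|J|%:R.
  by rewrite ler_pdivrMr // mulr_natl -sumr_const; apply: ler_sum.
have u_pos : #|[set j in J | 0 < y j]|%:R <= u.
  rewrite ler_pdivlMr // mulr_natl -sumr_const /p1.
  rewrite [leRHS](bigID (fun j => 0 < y j)) /= -[leLHS]addr0 lerD //.
    rewrite le_eqVlt; apply/orP; left; apply/eqP.
    apply: eq_big => [j|j]; rewrite !inE //.
    move=> /andP[_ yj]; rewrite /x; symmetry; apply/min_idPr.
    by rewrite leNgt; apply/negP => fk; move: yj; rewrite /y /x (min_idPl (ltW fk)) subrr ltxx.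
  by apply: sumr_ge0 => j /andP[/x0].
set L := Num.max (K - k) u.
have L0 : 0 < L by rewrite lt_max subr_gt0 kK.
have hy : \sum_(j in J) y j ^+ 2 + \sum_(i in J) \sum_(j in J) Num.min (y i) (y j)
    <= (p - k * u) * (L + (p - k * u) / L).
  rewrite -py; apply: sum_min_le => //.
    move=> j jJ; rewrite y0 /= le_max; apply/orP; left; rewrite /y /x.
    have /andP[f0 fK] := f_ge0 jJ.
    have [fk|fk] := leP (f j) k; first by rewrite subrr subr_ge0 ltW.
    by rewrite lerB.
  rewrite (le_trans _ (_ : u <= L)) ?le_max ?lexx ?orbT // (le_trans _ u_pos) //.
  rewrite ler_nat subset_leq_card //; apply/subsetP=> j.
  by rewrite !inE => /andP[-> /andP[->]].
have minD i j : Num.min (f i) (f j) = Num.min (x i) (x j) + Num.min (y i) (y j).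
  exact: minr_truncate.
have sqD j : f j ^+ 2 = x j ^+ 2 + (2 * k * y j + y j ^+ 2).
  rewrite /y /x; case: (leP (f j) k) => h1; ring.
exists u; split.
- by rewrite u_lo.
- by rewrite ku /p1 /p; apply: ler_sum.
rewrite /S (eq_bigr _ (fun j _ => sqD j)) big_split /= big_split /= -mulr_sumr py.
have -> : \sum_(i in J) \sum_(j in J) Num.min (f i) (f j) =
  \sum_(i in J) \sum_(j in J) Num.min (x i) (x j) +
  \sum_(i in J) \sum_(j in J) Num.min (y i) (y j).
  rewrite -big_split /=; apply: eq_bigr => i _; rewrite -big_split /=.
  by apply: eq_bigr => j _.
have E : p1 * (k + p1 / k) = k * u ^+ 2 + k ^+ 2 * u.
  by rewrite -/u -ku; ring.
rewrite E in hx; rewrite -/L; lra.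
Qed.

End MinSums.

(** * Subsets of prescribed size *)

Section Subsets.
Local Open Scope nat_scope.

Lemma exists_subset_card (T : finType) (A : {set T}) m : m <= #|A| ->
  exists2 B : {set T}, B \subset A & #|B| = m.
Proof.
move=> mA; exists [set x in take m (enum A)].
  by apply/subsetP => x; rewrite inE => /mem_take; rewrite mem_enum.
rewrite cardsE (card_uniqP _) ?take_uniq ?enum_uniq // size_take -cardE.
by case: ltngtP mA.
Qed.

Lemma exists_subset_between (T : finType) (A B : {set T}) m :
  A \subset B -> #|A| <= m <= #|B| ->
  exists C : {set T}, [/\ A \subset C, C \subset B & #|C| = m].
Proof.
move=> AB /andP[Am mB].
have [D DB cD] : exists2 D : {set T}, D \subset B :\: A & #|D| = m - #|A|.
  by apply: exists_subset_card; rewrite cardsD (setIidPr AB) leq_sub2r.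
exists (A :|: D); split; first exact: subsetUl.
  by rewrite subUset AB (subset_trans DB) ?subsetDl.
rewrite cardsU cD (_ : A :&: D = set0) ?cards0 ?subn0 ?subnKC //.
apply/eqP; rewrite setI_eq0 disjoint_sym disjoints_subset (subset_trans DB) //.
by rewrite setDE subsetIr.
Qed.

End Subsets.

(** * Structure of the extremal graphs *)

Section Graph.
Local Open Scope nat_scope.
Variable n : nat.
Implicit Types (G : graph n) (u v w : 'I_n) (e : {set 'I_n}) (I S : {set 'I_n}).

Definition adj G u v := [set u; v] \in edges G.

Lemma card_edge G e : e \in edges G -> #|e| = 2.
Proof. by move=> eG; have /forallP/(_ e)/implyP/(_ eG)/eqP := valP G. Qed.

Lemma graph_of_edges (E : {set {set 'I_n}}) :
  (forall e, e \in E -> #|e| = 2) -> exists G, edges G = E.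
Proof.
move=> hE; have H : [forall e in E, #|e : {set 'I_n}| == 2].
  by apply/forallP => e; apply/implyP => /hE ->.
by exists (exist _ E H).
Qed.

Lemma adjC G u v : adj G u v = adj G v u.
Proof. by rewrite /adj setUC. Qed.

Lemma adj_neq G u v : adj G u v -> u != v.
Proof. by move=> /card_edge; rewrite cards2; case: (u != v). Qed.

Lemma adjxx G u : adj G u u = false.
Proof. by apply/negP => /adj_neq; rewrite eqxx. Qed.

Lemma edge_at G e v : e \in edges G -> v \in e ->
  exists u, e = [set v; u].
Proof.
move=> eG ve; have /eqP/cards2P[x [y [xy E]]] := card_edge eG.
move: ve; rewrite E !inE => /orP[]/eqP->; first by exists y.
by exists x; rewrite setUC.
Qed.

Lemma degree_card G v : degree G v = #|[set u | adj G v u]|.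
Proof.
rewrite /degree -(card_in_imset (f := fun u => [set v; u]) (D := [set u | adj G v u])).
  congr #|pred_of_set _|; apply/setP => e; rewrite !inE; apply/andP/imsetP.
    move=> [eG ve]; have [u E] := edge_at eG ve.
    by exists u => //; rewrite inE /adj -E.
  by move=> [u]; rewrite inE => a ->; rewrite -/(adj G v u) a !inE eqxx.
move=> u w; rewrite !inE => /adj_neq vu /adj_neq vw /setP/(_ u).
by rewrite !inE eqxx orbT [u == v]eq_sym (negbTE vu) /= => /esym/eqP.
Qed.

Lemma degree_sum_edges G v : degree G v = \sum_(e in edges G) (v \in e).
Proof.
rewrite /degree -sum1_card big_mkcond [RHS]big_mkcond; apply: eq_bigr => e _.
by rewrite inE; case: (e \in edges G); case: (v \in e).
Qed.

Lemma sum_degree G : \sum_v degree G v = 2 * #|edges G|.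
Proof.
under eq_bigr do rewrite degree_sum_edges.
rewrite exchange_big /= mulnC -sum_nat_const; apply: eq_bigr => e eG.
by rewrite -(card_edge eG) -sum1_card [RHS]big_mkcond; apply: eq_bigr => v _; case: (v \in e).
Qed.

Lemma swap_degree G G' e e' v : edges G' = e' |: (edges G :\ e) ->
  e \in edges G -> e' \notin edges G ->
  degree G' v + (v \in e) = degree G v + (v \in e').
Proof.
move=> E eG e'G; rewrite !degree_sum_edges E big_setU1 /=; last first.
  by rewrite !inE (negbTE e'G) andbF.
rewrite (big_setD1 e eG) /=; set z := \sum_(_ in _ :\ _) _.
by case: (v \in e); case: (v \in e') => /=; lia.
Qed.

(** For a fixed number of edges the degree sum is fixed, so maximising this amounts to maximising
    [nb_S2]. *)
Definition sumsq G := \sum_v degree G v ^ 2.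

(** The set has exactly [l] vertices, so that competing sets for the same graph can be compared by
    their degree sums. *)
Definition witness m l k G I :=
  [&& #|edges G| == m, independent G I, #|I| == l & [forall v in I, k <= degree G v]].

Lemma min_degree_le G S v : v \in S -> min_degree G S <= degree G v.
Proof.
rewrite /min_degree; have : v \in index_enum 'I_n by rewrite mem_index_enum.
elim: (index_enum _) => // x s IH; rewrite inE big_cons => /orP[/eqP <- vS|vs vS].
  by rewrite vS geq_minl.
case: ifP => _; last exact: IH.
by rewrite (leq_trans (geq_minr _ _)) // IH.
Qed.

(** The hypothesis [k <= n] takes care of the neutral element [n] of the minimum. *)
Lemma le_min_degree G S k : k <= n -> (forall v, v \in S -> k <= degree G v) ->
  k <= min_degree G S.
Proof.
move=> kn h; rewrite /min_degree; elim/big_ind : _ => //.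
by move=> x y kx ky; rewrite leq_min kx.
Qed.

Lemma independentP G I : reflect {in I &, forall u v, ~~ adj G u v} (independent G I).
Proof.
apply: (iffP forallP) => [h u v uI vI|h e].
  apply/negP => a; have := h [set u; v]; rewrite -/(adj G u v) a /= => /negP; apply.
  by apply/subsetP => x; rewrite !inE => /orP[]/eqP->.
apply/implyP => eG; apply/negP => /subsetP eI.
have /eqP/cards2P[x [y [xy E]]] := card_edge eG.
have := h x y; rewrite /adj -E eG => H; apply: (negP (H _ _)) => //;
  by apply: eI; rewrite E !inE eqxx ?orbT.
Qed.

Lemma family_witness m l k G : G \in graph_family n m l k -> exists I, witness m l k G I.
Proof.
rewrite inE => /andP[Em /existsP[I /and3P[iI lI kI]]].
have [J JI Jl] : exists2 J : {set 'I_n}, J \subset I & #|J| = l.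
  exact: exists_subset_card.
exists J; apply/and4P; split=> //.
- apply/independentP => u v uJ vJ; move/independentP: iI; apply; exact: (subsetP JI).
- by rewrite Jl.
apply/forallP => v; apply/implyP => vJ; apply: leq_trans kI _.
exact/min_degree_le/(subsetP JI).
Qed.

(** * Edge exchanges in an extremal graph *)

Section Extremal.
Variables (m l k : nat) (G : graph n) (I : {set 'I_n}).
Hypothesis GI : witness m l k G I.
Hypothesis Gmax : forall G' I', witness m l k G' I' -> sumsq G' <= sumsq G.
Hypothesis Imin : forall I', witness m l k G I' ->
  \sum_(v in I) degree G v <= \sum_(v in I') degree G v.

Local Notation d := (degree G).
Local Notation "u ~ v" := (adj G u v) (at level 70).

(** Replacing [e] by [e'] changes the sum of squares by twice the difference of the two degree sums,
    plus one for each vertex on exactly one of the edges. This surplus is positive, so maximality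
    gives a strict inequality. The last hypothesis keeps the degrees in [I] at least [k]. *)
Lemma swap_lt e e' : e \in edges G -> e' \notin edges G -> #|e'| = 2 ->
  ~~ (e' \subset I) -> (forall v, v \in I -> v \in e -> v \in e' \/ k < d v) ->
  \sum_(v in e') d v < \sum_(v in e) d v.
Proof.
move=> eG e'G c2 e'I hk.
have [G' EG'] : exists G' : graph n, edges G' = e' |: (edges G :\ e).
  apply: graph_of_edges => x; rewrite !inE => /orP[/eqP->//|/andP[_ /card_edge //]].
have dd v := swap_degree v EG' eG e'G.
have /and4P[/eqP Em /independentP iI /eqP lI /forallP hd] := GI.
have wG' : witness m l k G' I.
  apply/and4P; split=> //.
  - rewrite EG' cardsU1 !inE (negbTE e'G) andbF /= add1n.
    by rewrite -Em (cardsD1 e (edges G)) eG.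
  - apply/forallP => x; apply/implyP; rewrite EG' !inE => /orP[/eqP->//|/andP[_ xG]].
    have /forallP/(_ x)/implyP/(_ xG) // : independent G I by exact/independentP.
  - by rewrite lI.
  - apply/forallP => v; apply/implyP => vI; have := dd v.
    have := implyP (hd v) vI; have := hk _ vI.
    case: (v \in e) => [[//|->|]|_]; case: (v \in e'); lia.
have := Gmax wG'; rewrite /sumsq.
have E : \sum_v (degree G' v ^ 2 + (d v * (v \in e) + d v * (v \in e))) =
   \sum_v (d v ^ 2 + (d v * (v \in e') + d v * (v \in e')) + ((v \in e) != (v \in e'))).
  apply: eq_bigr => v _; have := dd v; case: (v \in e); case: (v \in e') => /=; lia.
move: E; rewrite !big_split /=.
have sE (x : {set 'I_n}) : \sum_v d v * (v \in x) = \sum_(v in x) d v.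
  by rewrite [RHS]big_mkcond; apply: eq_bigr => v _; case: (v \in x); rewrite ?muln1 ?muln0.
rewrite !sE.
set D := \sum_(i < n) ((i \in e) != (i \in e')); have : 0 < D.
  rewrite /D lt0n sum_nat_eq0; apply/negP => /forallP h.
  have ee' : e = e' by apply/setP => v; have := h v; case: (v \in e); case: (v \in e').
  by rewrite -ee' eG in e'G.
move: D (\sum_v degree G' v ^ 2) (\sum_v d v ^ 2) => D x y.
move: (\sum_(v in e) d v) (\sum_(v in e') d v) => z t; lia.
Qed.

Lemma swap_sharing x y y' : x ~ y' -> ~~ (x ~ y) -> x != y -> y \notin I ->
  (y' \in I -> k < d y') -> d y < d y'.
Proof.
move=> a na xy yI hk.
have := @swap_lt [set x; y'] [set x; y] a na.
rewrite cards2 xy !big_setU1 ?inE ?(adj_neq a) //= !big_set1 ltn_add2l; apply=> //.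
  by apply/negP => /subsetP/(_ y); rewrite !inE eqxx orbT (negbTE yI) => /(_ isT).
move=> v vI; rewrite !inE => /orP[->|/eqP E]; first by left.
by right; rewrite E in vI *; exact: hk.
Qed.

Lemma neighbours_nested b b' x : b \notin I -> b' \notin I -> d b' <= d b ->
  x ~ b' -> x != b -> x ~ b.
Proof.
move=> bI b'I db a xb; apply: contraT => na.
have : d b < d b' by apply: swap_sharing a na xb bI _; rewrite (negbTE b'I).
by rewrite ltnNge db.
Qed.

Lemma swap_disjoint i o c o' : i ~ o -> ~~ (c ~ o') -> c != o' -> c \notin I ->
  i != c -> i != o' -> o != c -> o != o' -> (i \in I -> k < d i) -> (o \in I -> k < d o) ->
  d c + d o' < d i + d o.
Proof.
move=> a na co' cI ic io' oc oo' hi ho.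
have := @swap_lt [set i; o] [set c; o'] a na.
rewrite cards2 co' !big_setU1 ?inE ?(adj_neq a) //= !big_set1; apply=> //.
  by apply/negP => /subsetP/(_ c); rewrite !inE eqxx (negbTE cI) => /(_ isT).
by move=> v vI; rewrite !inE => /orP[]/eqP E; right; rewrite E in vI *; [exact: hi|exact: ho].
Qed.

Let outer (C : {set 'I_n}) := ~: (C :|: I).
Let Iplus (C : {set 'I_n}) := [set i in I | [exists o in outer C, i ~ o]].

Let top (C : {set 'I_n}) := [&& C \subset ~: I,
  [forall u in C, forall v in C, (u != v) ==> (u ~ v)] &
  [forall c in C, forall b in outer C, d b <= d c]].

Lemma degree_le_witness i : i \in I -> d i <= n - l.
Proof.
have /and4P[_ /independentP iI /eqP lI _] := GI.
move=> iiI; have -> : n - l = #|~: I| by rewrite [RHS]cardsCs setCK card_ord lI.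
rewrite degree_card subset_leq_card //; apply/subsetP => u; rewrite !inE => a.
by apply/negP => /(iI _ _ iiI)/negP.
Qed.

(* C is a largest clique outside I that contains, with a vertex, all vertices outside
   I of larger degree.  In the last clause some vertex of O adjacent to I has degree
   less than k: otherwise neighbours in O of a vertex of Iplus could be exchanged with
   Iplus, lowering the degree sum of I. *)
Lemma extremal_structure : exists C : {set 'I_n},
  [/\ C \subset ~: I, {in C &, forall u v, u != v -> u ~ v},
    {in outer C &, forall u v, ~~ (u ~ v)},
    (forall i o c, i \in I -> o \in outer C -> c \in C -> i ~ o -> i ~ c) &
    k <= #|C| -> forall i o o', i \in I -> o \in outer C -> o' \in outer C -> i ~ o ->
      d o' + #|C| + #|Iplus C| < n - l + k].
Proof.
have /and4P[/eqP Em /independentP iI /eqP lI /forallP hd] := GI.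
have top0 : top set0.
  apply/and3P; split; first exact: sub0set.
    by apply/forallP => u; rewrite inE.
  by apply/forallP => u; rewrite inE.
pose C := [arg max_(C > set0 | top C) #|C|].
have [topC Cmax] : top C /\ forall D, top D -> #|D| <= #|C|.
  by rewrite /C; case: arg_maxnP.
have /and3P[CI /forallP Ccl /forallP Cup] := topC.
have clique : {in C &, forall u v, u != v -> u ~ v}.
  move=> u v uC vC; have /forallP/(_ v)/implyP/(_ vC)/implyP := implyP (Ccl u) uC.
  exact.
have up c b : c \in C -> b \in outer C -> d b <= d c.
  by move=> cC bO; have /forallP/(_ b)/implyP/(_ bO) := implyP (Cup c) cC.
have CnI c : c \in C -> c \notin I by move=> /(subsetP CI); rewrite inE.
have OnI o : o \in outer C -> o \notin I by rewrite !inE negb_or => /andP[].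
have OnC o : o \in outer C -> o \notin C by rewrite !inE negb_or => /andP[].
have [O0|[o2 o2O]] := set_0Vmem (outer C).
  exists C; split=> //; rewrite ?O0; first by move=> u v; rewrite inE.
    by move=> i o c _; rewrite inE.
  by move=> _ i o o' _; rewrite inE.
pose o1 := [arg max_(o > o2 | o \in outer C) d o].
have [o1O o1max] : o1 \in outer C /\ forall o, o \in outer C -> d o <= d o1.
  by rewrite /o1; case: arg_maxnP.
(* If all of [C] were adjacent to [o1], a vertex of largest degree in O, adding [o1] to [C] would
   give a larger clique of the same kind. *)
have [c0 c0C c0o1] : exists2 c0, c0 \in C & ~~ (c0 ~ o1).
  apply/exists_inP; apply: contraT; rewrite negb_exists_in => /forall_inP adjo1.
  have {}adjo1 c : c \in C -> c ~ o1 by move=> /adjo1; rewrite negbK.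
  suff /Cmax : top (o1 |: C) by rewrite cardsU1 (OnC _ o1O) add1n ltnn.
  have out_sub b : b \in outer (o1 |: C) -> b \in outer C.
    by rewrite !inE !negb_or => /andP[/andP[_ ->] ->].
  apply/and3P; split.
  - by rewrite subUset CI andbT sub1set inE OnI.
  - apply/forall_inP => u /setU1P uC; apply/forall_inP => v /setU1P vC; apply/implyP => uv.
    case: uC vC uv => [->|uC] [->|vC] uv; first by rewrite eqxx in uv.
    + by rewrite adjC adjo1.
    + exact: adjo1.
    + exact: clique.
  - apply/forall_inP => c /setU1P cC; apply/forall_inP => b /out_sub bO.
    by case: cC => [->|cC]; [exact: o1max|exact: up].
have c0o1' : c0 != o1 by apply: contraNneq (OnC _ o1O) => <-.
have CO c o : c \in C -> o \in outer C -> c != o.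
  by move=> cC oO; apply: contraNneq (OnC _ oO) => <-.
have IO i o : i \in I -> o \in outer C -> i != o.
  by move=> iiI oO; apply: contraNneq (OnI _ oO) => <-.
have IC i c : i \in I -> c \in C -> i != c.
  by move=> iiI cC; apply: contraNneq (CnI _ cC) => <-.
(* An edge [u v] inside O would make [v] adjacent to [c0], and then [c0] adjacent to [o1], both by
   nestedness. *)
have indO : {in outer C &, forall u v, ~~ (u ~ v)}.
  move=> u v uO vO; apply/negP => uv.
  have vc0 : v ~ c0.
    apply: (@neighbours_nested c0 u v); [exact: CnI|exact: OnI|exact: up|by rewrite adjC|].
    by rewrite eq_sym CO.
  have [E|vo1] := eqVneq v o1; first by rewrite -E adjC vc0 in c0o1.
  case/negP: c0o1; apply: (@neighbours_nested o1 v c0) => //; [exact: OnI|exact: OnI|exact: o1max|].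
  by rewrite adjC.
have IOC i o c : i \in I -> o \in outer C -> c \in C -> i ~ o -> i ~ c.
  move=> iiI oO cC io.
  by apply: (@neighbours_nested c o i) => //; [exact: CnI|exact: OnI|exact: up|exact: IC].
have IOo1 i o : i \in I -> o \in outer C -> i ~ o -> i ~ o1.
  move=> iiI oO io; apply: (@neighbours_nested o1 o i) => //;
    [exact: OnI|exact: OnI|exact: o1max|exact: IO].
exists C; split=> // kC i o o' iiI oO o'O io.
(* Vertices of [I] with a neighbour in O have degree above [k], so they may lose an edge in an
   exchange. *)
have degI j p : j \in I -> p \in outer C -> j ~ p -> #|C| < d j.
  move=> jI pO jp; rewrite degree_card; apply: (@leq_trans #|p |: C|).
    by rewrite cardsU1 OnC.
  apply: subset_leq_card; apply/subsetP => x; rewrite !inE => /orP[/eqP->//|xC].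
  exact: IOC jp.
have c0lt j p : j \in I -> p \in outer C -> j ~ p -> d c0 < d j.
  move=> jI pO jp; apply: (@swap_sharing o1).
  - by rewrite adjC; exact: IOo1 jp.
  - by rewrite adjC.
  - by rewrite eq_sym.
  - exact: CnI.
  - by move=> _; rewrite (leq_ltn_trans kC) // (degI _ p).
(* The successor accounts for [c0] itself, which is not its own neighbour. *)
have dc0 : #|C| + #|Iplus C| <= (d c0).+1.
  rewrite degree_card -cardsUI (_ : C :&: Iplus C = set0) ?cards0 ?addn0; last first.
    apply/setP => x; rewrite !inE; apply/negP => /andP[/CnI/negbTE->].
    by [].
  rewrite -add1n -(cards1 c0) (leq_trans _ (leq_card_setU _ _)) //.
  apply: subset_leq_card; apply/subsetP => x; rewrite !inE => /orP[xC|].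
    by have [//|/= xc0] := eqVneq x c0; rewrite clique // eq_sym.
  case/andP=> xI /exists_inP[p pO xp]; apply/orP; right.
  by rewrite adjC; exact: IOC xp.
have [o3 [i3 [o3O i3I i3o3 dk]]] : exists o3 i3, [/\ o3 \in outer C, i3 \in I, i3 ~ o3 & d o3 < k].
  pose N := [set o in outer C | [exists i in I, i ~ o]].
  have [/exists_inP[o3]|] := boolP [exists o3 in N, d o3 < k].
    by rewrite inE => /andP[o3O /exists_inP[i3 i3I i3o3]] dk; exists o3, i3.
  rewrite negb_exists_in => /forall_inP Nk; exfalso.
  pose Ni := [set p in outer C | i ~ p].
  have NiN : Ni \subset N.
    apply/subsetP => p; rewrite !inE => /andP[-> ip] /=; apply/exists_inP; by exists i.
  have di : d i = #|C| + #|Ni|.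
    rewrite degree_card -cardsUI (_ : C :&: Ni = set0) ?cards0 ?addn0; last first.
      by apply/setP => x; rewrite !inE; case: (x \in C) => //=; rewrite andbF.
    congr #|pred_of_set _|; apply/setP => x; rewrite !inE; apply/idP/orP; last first.
      by case=> [xC|/andP[]//]; exact: IOC io.
    move=> ix; have [xC|xC] := boolP (x \in C); [by left|right].
    rewrite ix andbT orFb; apply/negP => /(iI _ _ iiI); by rewrite ix.
  (* Compare [dc0] with [d c0 < d i] and [d i = #|C| + #|Ni|]: there are enough neighbours of [i] in
     O to replace all of [Iplus C]. *)
  have cNi : #|Iplus C| <= #|Ni|.
    have h := c0lt _ _ iiI oO io; rewrite di in h.
    by rewrite -(leq_add2l #|C|); exact: leq_trans dc0 h.
  have [D DNi cD] : exists2 D : {set 'I_n}, D \subset Ni & #|D| = #|Iplus C|.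
    exact: exists_subset_card.
  have DO x : x \in D -> x \in outer C.
    by move=> /(subsetP DNi); rewrite inE => /andP[].
  pose I' := D :|: (I :\: Iplus C).
  have IpI : Iplus C \subset I by apply/subsetP => x; rewrite inE => /andP[].
  have disj : D :&: (I :\: Iplus C) = set0.
    apply/setP => x; rewrite in_setI in_setD in_set0.
    by apply/negP => /and3P[/DO/OnI h _ xI]; rewrite xI in h.
  have wI' : witness m l k G I'.
    apply/and4P; split; first by rewrite Em.
    - have DI u v : u \in D -> v \in I :\: Iplus C -> ~~ (v ~ u).
        rewrite in_setD => /DO uO /andP[vp vI]; apply: contra vp => vu.
        by rewrite inE vI /=; apply/exists_inP; exists u.
      apply/independentP => u v /setUP[uD|uI] /setUP[vD|vI].
      + exact: indO (DO _ uD) (DO _ vD).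
      + by rewrite adjC; exact: DI.
      + exact: DI.
      + by apply: iI; [move: uI|move: vI]; rewrite in_setD => /andP[].
    - rewrite cardsU disj cards0 subn0 cD cardsD (setIidPr IpI) lI.
      by have := subset_leq_card IpI; rewrite lI => /subnKC ->.
    - apply/forall_inP => v /setUP[vD|]; last first.
        by rewrite in_setD => /andP[_ vI]; exact: (implyP (hd v)).
      have /Nk : v \in N by apply: (subsetP NiN); exact: (subsetP DNi).
      by rewrite -leqNgt.
  have := Imin wI'; rewrite leqNgt => /negP; apply.
  rewrite [X in _ < X](big_setID (Iplus C)) /= (setIidPr IpI).
  have -> : \sum_(v in I') d v = \sum_(v in D) d v + \sum_(v in I :\: Iplus C) d v.
    rewrite -bigU /=; last by rewrite -setI_eq0 disj.
    by apply: eq_bigl => x; rewrite in_setU [RHS]inE.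
  rewrite ltn_add2r.
  apply: (@leq_ltn_trans (\sum_(v in D) d c0)).
    by apply: leq_sum => v /DO vO; exact: up.
  rewrite sum_nat_const cD -sum_nat_const.
  have iip : i \in Iplus C by rewrite inE iiI; apply/exists_inP; exists o.
  rewrite (bigD1 i) //= [X in _ < X](bigD1 i) //= -addSn leq_add //.
    exact: c0lt io.
  apply: leq_sum => j /andP[]; rewrite inE => /andP[jI /exists_inP[p pO jp]] _.
  by rewrite ltnW // (c0lt _ p).
(* The edge [i3 o3] is exchanged for the non-edge [c0 o1]. The right side is small, as
   [d i3 <= n - l] and [d o3 < k]. *)
have main : d c0 + d o1 < d i3 + d o3.
  have [E|o31] := eqVneq o3 o1.
    by rewrite -E ltn_add2r; exact: c0lt i3o3.
  apply: swap_disjoint => //; [exact: CnI|exact: IC|exact: IO|by rewrite eq_sym CO| |].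
    by move=> _; rewrite (leq_ltn_trans kC) // (degI _ o3).
  by move=> h; have := OnI _ o3O; rewrite h.
have h1 : d o' + (#|C| + #|Iplus C|) <= d o1 + (d c0).+1.
  by rewrite leq_add // o1max.
rewrite -addnA (leq_ltn_trans h1) // addnS addnC (leq_ltn_trans main) //.
by rewrite -addnS leq_add // degree_le_witness.
Qed.

End Extremal.
End Graph.

(** * Edge counts *)

Section Count.
Variables (R : realFieldType) (n : nat) (G : graph n) (I C : {set 'I_n}).
Let O := ~: (C :|: I).
Let J := ~: C.
Let Ip := [set i in I | [exists o in O, adj G i o]].
Hypothesis CI : C \subset ~: I.
Hypothesis clique : {in C &, forall u v, u != v -> adj G u v}.
Hypothesis indO : {in O &, forall u v, ~~ adj G u v}.
Hypothesis indI : {in I &, forall u v, ~~ adj G u v}.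
Hypothesis IOC : forall i o c, i \in I -> o \in O -> c \in C -> adj G i o -> adj G i c.

Let a u v : R := (adj G u v)%:R.
Let d v : R := (degree G v)%:R.
Let K : R := #|C|%:R.
Let w : R := #|O|%:R.
Let mu : R := #|Ip|%:R.
Let f j := \sum_(c in C) a j c.
Let g c := \sum_(j in J) a c j.
Let ei i := \sum_(o in O) a i o.
Let eo o := \sum_(i in I) a o i.
Let p := \sum_(j in J) f j.
Let x := \sum_(i in I) ei i.
Let S := \sum_(j in J) f j ^+ 2 + \sum_(i in J) \sum_(j in J) Num.min (f i) (f j).

Lemma sum_splitJ (F : 'I_n -> R) :
  \sum_(j in J) F j = \sum_(i in I) F i + \sum_(o in O) F o.
Proof.
rewrite (big_setID I) /=; congr (_ + _); apply: eq_bigl => v; rewrite !inE.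
  by rewrite andbC; case: (boolP (v \in I)) => //= vI;
    apply/negP => /(subsetP CI); rewrite inE vI.
by rewrite negb_or andbC.
Qed.

Lemma sum_splitC (F : 'I_n -> R) :
  \sum_v F v = \sum_(c in C) F c + \sum_(j in J) F j.
Proof.
rewrite (bigID (mem C)) /=; congr (_ + _); apply: eq_bigl => v; by rewrite !inE.
Qed.

Lemma degree_sum_adj v : d v = \sum_u a v u.
Proof.
rewrite /d degree_card -sum1_card natr_sum big_mkcond /=; apply: eq_bigr => u _.
by rewrite inE /a; case: (adj G v u).
Qed.

Lemma adjRC u v : a u v = a v u. Proof. by rewrite /a adjC. Qed.
Lemma adjR_ge0 u v : 0 <= a u v. Proof. exact: ler0n. Qed.
Lemma adjR_le1 u v : a u v <= 1. Proof. by rewrite /a lern1 leq_b1. Qed.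

Lemma sum_a_le (A : {set 'I_n}) v : \sum_(u in A) a v u <= #|A|%:R.
Proof. by rewrite -sum1_card natr_sum; apply: ler_sum => u _; exact: adjR_le1. Qed.

Lemma sum_a_ge0 (A : {set 'I_n}) v : 0 <= \sum_(u in A) a v u.
Proof. by apply: sumr_ge0 => u _; exact: adjR_ge0. Qed.

Lemma degree_clique c : c \in C -> d c = K - 1 + g c.
Proof.
move=> cC; rewrite degree_sum_adj sum_splitC; congr (_ + _).
rewrite (bigD1 c) //= {1}/a adjxx add0r /K (cardsD1 c) cC natrD addrAC subrr add0r.
rewrite -sum1_card natr_sum; apply: eq_big => [u|u /andP[uC uc]].
  by rewrite !inE andbC.
by rewrite /a clique // eq_sym.
Qed.

Lemma degree_indep i : i \in I -> d i = f i + ei i.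
Proof.
move=> iI; rewrite degree_sum_adj sum_splitC sum_splitJ [X in _ + (X + _)]big1 ?add0r //.
by move=> u uI; rewrite /a (negbTE (indI _ _)).
Qed.

Lemma degree_outer o : o \in O -> d o = f o + eo o.
Proof.
move=> oO; rewrite degree_sum_adj sum_splitC sum_splitJ; congr (_ + _).
rewrite [X in _ + X]big1 ?addr0 //.
by move=> u uO; rewrite /a (negbTE (indO _ _)).
Qed.

Lemma sum_g : \sum_(c in C) g c = p.
Proof.
by rewrite /g exchange_big /=; apply: eq_bigr => j _; apply: eq_bigr => c _; rewrite adjRC.
Qed.

Lemma sum_eo : \sum_(o in O) eo o = x.
Proof.
by rewrite /eo exchange_big /=; apply: eq_bigr => j _; apply: eq_bigr => c _; rewrite adjRC.
Qed.

(** Expanding the squares counts, for each pair [i], [j], the common neighbours in [C], of which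
    there are at most [f i] and at most [f j]. *)
Lemma sum_gsq : \sum_(c in C) g c ^+ 2 <= \sum_(i in J) \sum_(j in J) Num.min (f i) (f j).
Proof.
have -> : \sum_(c in C) g c ^+ 2 =
    \sum_(i in J) \sum_(j in J) \sum_(c in C) a c i * a c j.
  under eq_bigr do rewrite expr2 /g mulr_suml.
  rewrite exchange_big /=; apply: eq_bigr => i _.
  under eq_bigr do rewrite mulr_sumr.
  by rewrite exchange_big.
apply: ler_sum => i _; apply: ler_sum => j _; rewrite le_min; apply/andP; split;
  apply: ler_sum => c _.
  by rewrite -[leRHS]mulr1 [a i c]adjRC ler_wpM2l ?adjR_ge0 ?adjR_le1.
by rewrite -[leRHS]mul1r [a j c]adjRC ler_wpM2r ?adjR_ge0 ?adjR_le1.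
Qed.

Lemma sum_degree_split : K ^+ 2 - K + 2 * p + 2 * x = \sum_v d v.
Proof.
have hC : \sum_(c in C) d c = K * (K - 1) + p.
  by rewrite (eq_bigr _ degree_clique) big_split /= sum_g sumr_const -mulr_natl.
have hI : \sum_(i in I) d i = \sum_(i in I) f i + x.
  by rewrite (eq_bigr _ degree_indep) big_split.
have hO : \sum_(o in O) d o = \sum_(o in O) f o + x.
  by rewrite (eq_bigr _ degree_outer) big_split /= sum_eo.
have hp : p = \sum_(i in I) f i + \sum_(o in O) f o by rewrite /p sum_splitJ.
by rewrite sum_splitC sum_splitJ hC hI hO hp; ring.
Qed.

Lemma p_ge0 : 0 <= p.
Proof. by apply: sumr_ge0 => j _; exact: sum_a_ge0. Qed.

Lemma cross_ge0 : 0 <= x.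
Proof. by apply: sumr_ge0 => j _; exact: sum_a_ge0. Qed.

Lemma ei_eq0 i : i \in I -> i \notin Ip -> ei i = 0.
Proof.
rewrite inE => iI; rewrite iI /= negb_exists_in => /forall_inP h.
by apply: big1 => o /h; rewrite /a => /negbTE ->.
Qed.

Lemma cross_le : x <= mu * w.
Proof.
rewrite /x (bigID (mem Ip)) /= [X in _ + X]big1 ?addr0; last first.
  by move=> i /andP[iI ip]; exact: ei_eq0.
have -> : \sum_(i in I | i \in Ip) ei i = \sum_(i in Ip) ei i.
  by apply: eq_bigl => i; rewrite !inE; case: (i \in I).
rewrite /mu mulr_natl -sumr_const; apply: ler_sum => i _; exact: sum_a_le.
Qed.

Lemma cross_eq0 : ~~ [exists i in I, exists o in O, adj G i o] -> x = 0.
Proof.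
rewrite negb_exists_in => /forall_inP h; apply: big1 => i iI.
apply: ei_eq0 => //; rewrite inE iI /=; exact: h.
Qed.

Lemma eo_le o : o \in O -> eo o <= mu.
Proof.
move=> oO; rewrite /eo (bigID (mem Ip)) /= [X in _ + X]big1 ?addr0; last first.
  move=> i /andP[iI ip]; rewrite /a; case: (boolP (adj G o i)) => // oi.
  by case/negP: ip; rewrite inE iI; apply/exists_inP; exists o => //; rewrite adjC.
have -> : \sum_(i in I | i \in Ip) a o i = \sum_(i in Ip) a o i.
  by apply: eq_bigl => i; rewrite !inE; case: (i \in I).
exact: sum_a_le.
Qed.

(** An edge between I and O is charged [2 * K + w] for its end in I and [Mo] for its end in O: a
    square [(f + e) ^+ 2] exceeds [f ^+ 2] by [e] times [2 * f + e]. *)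
Lemma sumsq_le Mo : (forall o, o \in O -> 2 * f o + eo o <= Mo) ->
  \sum_v d v ^+ 2 <= K ^+ 3 + 2 * K * p + S + x * (2 * K + w + Mo).
Proof.
move=> hMo; rewrite sum_splitC sum_splitJ.
have h1 : \sum_(c in C) d c ^+ 2 <= K ^+ 3 + 2 * K * p + \sum_(c in C) g c ^+ 2.
  have -> : K ^+ 3 + 2 * K * p + \sum_(c in C) g c ^+ 2 = \sum_(c in C) (K + g c) ^+ 2.
    under [RHS]eq_bigr do rewrite sqrrD -mulr_natr.
    rewrite !big_split /= sumr_const -mulr_suml -mulr_sumr sum_g -mulr_natl -/K; ring.
  apply: ler_sum => c cC; rewrite degree_clique // lerXn2r // ?nnegrE.
  - by rewrite addr_ge0 ?sum_a_ge0 // subr_ge0 /K ler1n (cardsD1 c) cC.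
  - by rewrite addr_ge0 ?sum_a_ge0.
  - by rewrite lerD2r gerBl.
have h2 : \sum_(i in I) d i ^+ 2 <= \sum_(i in I) f i ^+ 2 + x * (2 * K + w).
  rewrite /x mulr_suml -big_split /=; apply: ler_sum => i iI; rewrite degree_indep //.
  have e0 := sum_a_ge0 O i; have e1 := sum_a_le O i; have f1 := sum_a_le C i.
  have : ei i * (2 * f i + ei i) <= ei i * (2 * K + w).
    by rewrite ler_wpM2l // lerD // ler_wpM2l.
  by rewrite sqrrD -mulr_natr; lra.
have h3 : \sum_(o in O) d o ^+ 2 <= \sum_(o in O) f o ^+ 2 + x * Mo.
  rewrite -sum_eo mulr_suml -big_split /=; apply: ler_sum => o oO; rewrite degree_outer //.
  have e0 := sum_a_ge0 I o.
  have : eo o * (2 * f o + eo o) <= eo o * Mo by rewrite ler_wpM2l // hMo.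
  by rewrite sqrrD -mulr_natr; lra.
have := sum_gsq; have := sum_splitJ (fun j => f j ^+ 2).
by rewrite /S => -> h4; lra.
Qed.

Lemma S_le_one_level L : 0 < L -> K <= L -> n%:R - K <= L -> S <= p * (L + p / L).
Proof.
move=> L0 KL JL; apply: (@sum_min_le_max _ _ J f K) => //.
  by move=> j _; rewrite sum_a_ge0 sum_a_le.
by rewrite /J cardsCs setCK card_ord natrB // -[X in (_ <= X)%N]card_ord max_card.
Qed.

Lemma S_le_two_level k : (0 < k)%N -> (k < #|C|)%N -> (#|O| <= k)%N ->
  (forall i, i \in I -> k <= degree G i)%N ->
  exists u, [/\ #|I|%:R <= u <= n%:R - K, k%:R * u <= p &
    S <= k%:R * u ^+ 2 + k%:R ^+ 2 * u + 2 * k%:R * (p - k%:R * u) +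
     (p - k%:R * u) * (Num.max (K - k%:R) u + (p - k%:R * u) / Num.max (K - k%:R) u)].
Proof.
move=> k0 kK Ok hk.
have -> : n%:R - K = #|J|%:R.
  by rewrite /J cardsCs setCK card_ord natrB // -[X in (_ <= X)%N]card_ord max_card.
apply: (@sum_min_le_split _ _ J I f K k%:R).
- by move=> j _; rewrite sum_a_ge0 sum_a_le.
- by rewrite ltr0n.
- by rewrite ltr_nat.
- by rewrite /J; move: CI; rewrite -setCS setCK.
(* A vertex with a neighbour in O is adjacent to all of [C]; for any other vertex of [I] all
   neighbours lie in [C], so [f i] is its degree. *)
- move=> i iI; have [ip|ip] := boolP (i \in Ip).
    move: ip; rewrite inE => /andP[_ /exists_inP[o oO io]].
    have -> : f i = K.
      rewrite /f /K -sum1_card natr_sum; apply: eq_bigr => c cC.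
      by rewrite /a (IOC _ oO).
    by rewrite ler_nat ltnW.
  have := degree_indep iI; rewrite (ei_eq0 iI ip) addr0 => <-.
  by rewrite ler_nat hk.
- rewrite ler_nat (leq_trans _ Ok) // subset_leq_card //; apply/subsetP => v.
  by rewrite !inE negb_or andbC.
Qed.

End Count.

(** * Upper bound for the sum of squared degrees *)

Lemma extremal_witness n (m l k : nat) (G0 : graph n) I0 : witness m l k G0 I0 ->
  exists (G : graph n) I, [/\ witness m l k G I, (sumsq G0 <= sumsq G)%N,
    forall (G' : graph n) I', witness m l k G' I' -> (sumsq G' <= sumsq G)%N &
    forall I', witness m l k G I' ->
      (\sum_(v in I) degree G v <= \sum_(v in I') degree G v)%N].
Proof.
move=> w0; pose P (G : graph n) := [exists I, witness m l k G I].
have P0 : P G0 by apply/existsP; exists I0.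
pose G := [arg max_(G > G0 | P G) sumsq G].
have [/existsP[I1 w1] Gmax] : P G /\ forall G', P G' -> (sumsq G' <= sumsq G)%N.
  by rewrite /G; case: arg_maxnP.
pose I := [arg min_(I < I1 | witness m l k G I) \sum_(v in I) degree G v].
have [wI Imin] : witness m l k G I /\ forall I', witness m l k G I' ->
    (\sum_(v in I) degree G v <= \sum_(v in I') degree G v)%N.
  by rewrite /I; case: arg_minnP.
exists G, I; split=> //; first exact: Gmax.
by move=> G' I' w'; apply: Gmax; apply/existsP; exists I'.
Qed.

Lemma scale_div (R : realFieldType) (N p L : R) : 0 < N -> 0 < L ->
  p * (L * N + p / (L * N)) / N ^+ 3 = p / N ^+ 2 * (L + p / N ^+ 2 / L).
Proof. by move=> N0 L0; field; rewrite !gt_eqF. Qed.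

(** The structure of an extremal graph, divided by powers of [n], is fed into [total_le]. The
    summand [n] in the edge condition pays for the difference between [K ^+ 2] and [K ^+ 2 - K]. *)
Lemma sumsq_upper (R : realFieldType) n m l k (G : graph n) (q r s T : R)
    (a : R := l%:R / n%:R) (b : R := k%:R / n%:R) :
  (0 < n)%N -> G \in graph_family n m l k ->
  33/100 <= a <= 2/5 -> 9/46 <= b <= 1/5 -> 17/25 <= r <= 26/37 ->
  0 <= q -> q ^+ 2 = 1 - r -> 0 <= s -> s ^+ 2 + 2 * a * s = r ->
  2 * m%:R + n%:R <= r * n%:R ^+ 2 ->
  1 - 2 * q ^+ 2 + q ^+ 3 <= T -> s ^+ 3 + 3 * a * s ^+ 2 + a ^+ 2 * s <= T ->
  (sumsq G)%:R <= T * n%:R ^+ 3.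
Proof.
move=> n0 /family_witness[I0 w0] ha hb hr q0 hq s0 hs hm hQS hQC.
have [G' [I [wI GG' Gmax Imin]]] := extremal_witness w0.
apply: (@le_trans _ _ (sumsq G')%:R); first by rewrite ler_nat.
move: {G I0 w0 GG'} G' wI Gmax Imin => G wI Gmax Imin.
have [C [CI clique indO IOC dO]] := extremal_structure wI Gmax Imin.
have /and4P[/eqP Em /independentP indI /eqP lI /forall_inP hdI] := wI.
set O := ~: (C :|: I) in indO IOC dO.
set Ip := [set i in I | _] in dO.
set N : R := n%:R; have N0 : 0 < N by rewrite ltr0n.
pose K : R := #|C|%:R; pose p : R := \sum_(j in ~: C) \sum_(c in C) (adj G j c)%:R.
pose x : R := \sum_(i in I) \sum_(o in O) (adj G i o)%:R.
pose f (j : 'I_n) : R := \sum_(c in C) (adj G j c)%:R.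
pose S : R := \sum_(j in ~: C) f j ^+ 2 +
   \sum_(i in ~: C) \sum_(j in ~: C) Num.min (f i) (f j).
pose w : R := #|O|%:R; pose mu : R := #|Ip|%:R.
have p0 : 0 <= p := p_ge0 _ _ _.
have x0 : 0 <= x := cross_ge0 _ _ _ _.
have w0 : 0 <= w by exact: ler0n.
have mu0 : 0 <= mu by exact: ler0n.
have K0 : 0 <= K by exact: ler0n.
have cards : K + w + l%:R = N.
  rewrite -!natrD; congr _%:R.
  have h : #|C :|: I| = (#|C| + #|I|)%N.
    rewrite -cardsUI (_ : C :&: I = set0) ?cards0 ?addn0 //.
    by apply/eqP; rewrite setI_eq0 disjoints_subset.
  by rewrite -[RHS]card_ord -(cardsC (C :|: I)) h lI -/O addnAC.
have mul : mu <= l%:R.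
  by rewrite ler_nat -lI subset_leq_card //; apply/subsetP => v; rewrite inE => /andP[].
have xmu : x <= mu * w := cross_le _ _ _ _.
have hsum : K ^+ 2 - K + 2 * p + 2 * x = 2 * m%:R.
  rewrite (sum_degree_split R CI clique indO indI) -natr_sum sum_degree Em natrM //.
have lN : l%:R = a * N by rewrite /a divfK // gt_eqF.
have kN : k%:R = b * N by rewrite /b divfK // gt_eqF.
pose t := K / N.
have KN : K = t * N by rewrite /t divfK // gt_eqF.
have om : 1 - a - t = w / N.
  have -> : w = N - K - l%:R by rewrite -cards; ring.
  by rewrite lN KN; field; rewrite gt_eqF.
(* Besides the trivial bound [2 * K + mu], twice the degree bound of [extremal_structure] is
   available when some edge joins [I] to [O] and [k <= #|C|]. *)
pose Mo : R := if [exists i in I, exists o in O, adj G i o] then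
   (if (k <= #|C|)%N then Num.min (2 * K + mu) (2 * (N - l%:R + k%:R - K - mu)) else 2 * K + mu)
   else 2 * K + mu.
have f_le o : f o <= K := sum_a_le R G C o.
have hMo o : o \in O -> 2 * f o + \sum_(i in I) (adj G o i)%:R <= Mo.
  move=> oO; have h1 : 2 * f o + \sum_(i in I) (adj G o i)%:R <= 2 * K + mu.
    by apply: lerD; [rewrite ler_pM2l // f_le|exact: eo_le].
  rewrite /Mo; case: ifPn => // /exists_inP[i iI /exists_inP[o1 o1O io1]].
  case: ifPn => // kC; rewrite le_min h1 /=.
  have := dO kC i o1 o iI o1O oO io1; rewrite -(ltr_nat R) => h2.
  have h3 : (degree G o)%:R = f o + \sum_(i in I) (adj G o i)%:R.
    exact: (degree_outer R CI indO oO).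
  have f0 : 0 <= \sum_(i in I) (adj G o i)%:R :> R := sum_a_ge0 R G I o.
  have h4 : (n - l)%:R = N - l%:R.
    rewrite natrB // -lI -[X in (_ <= X)%N]card_ord; exact: max_card.
  by move: h2; rewrite !natrD h4 h3 -/K -/mu; clear -f0; lra.
have total := sumsq_le CI clique indO indI hMo.
have hE : (sumsq G)%:R = \sum_v (degree G v)%:R ^+ 2 :> R.
  by rewrite /sumsq natr_sum; apply: eq_bigr => v _; rewrite natrX.
rewrite hE (le_trans total) // -/K -/p -/S -/x -/w.
have -> : K ^+ 3 + 2 * K * p + S + x * (2 * K + w + Mo) =
  (t ^+ 3 + 2 * t * (p / N ^+ 2) + S / N ^+ 3 + (x / N ^+ 2) * ((2 * K + w + Mo) / N)) * N ^+ 3.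
  by rewrite KN; field; rewrite gt_eqF.
rewrite ler_pM2r ?exprn_gt0 //.
have N2 : 0 < N ^+ 2 by rewrite exprn_gt0.
have N3 : 0 < N ^+ 3 by rewrite exprn_gt0.
apply: (total_le ha hb hr q0 hq s0 hs) => //.
- by rewrite divr_ge0 // ltW.
- by rewrite om divr_ge0 // ltW.
- by rewrite divr_ge0 // ltW.
- by rewrite divr_ge0 // ltW.
- have -> : t ^+ 2 + 2 * (p / N ^+ 2) + 2 * (x / N ^+ 2) = (2 * m%:R + K) / N ^+ 2.
    by rewrite -hsum /t; field; rewrite gt_eqF.
  rewrite ler_pdivrMr // (le_trans _ hm) // lerD2l.
  by rewrite ler_nat -[X in (_ <= X)%N]card_ord max_card.
- move=> L tL zL.
  have L0 : 0 < L by clear -tL zL; lra.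
  rewrite -scale_div // ler_pM2r ?invr_gt0 //.
  apply: S_le_one_level; first by rewrite mulr_gt0.
    by rewrite -/K KN ler_pM2r.
  by rewrite -/K KN -/N -[X in X - _]mul1r -mulrBl ler_pM2r.
- rewrite om => omb bt.
  have k0 : (0 < k)%N by rewrite -(ltr0n R) kN mulr_gt0 //; clear -hb; lra.
  have kK : (k < #|C|)%N by rewrite -(ltr_nat R) -/K KN kN ltr_pM2r.
  have Ok : (#|O| <= k)%N by rewrite -(ler_nat R) -/w kN -ler_pdivrMr.
  have [u [/andP[u1 u2] kup hS]] := S_le_two_level R CI indI IOC k0 kK Ok hdI.
  exists (u / N); split.
  + apply/andP; split; first by rewrite ler_pdivlMr // -lN -lI.
    by rewrite ler_pdivrMr // mulrBl mul1r -KN.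
  + have -> : b * (u / N) = k%:R * u / N ^+ 2 by rewrite kN; field; rewrite gt_eqF.
    by rewrite ler_pM2r ?invr_gt0.
  + have hL : Num.max (t - b) (u / N) = Num.max (K - k%:R) u / N.
      have -> : t - b = (K - k%:R) / N by rewrite KN kN; field; rewrite gt_eqF.
      by rewrite maxr_pMl // invr_ge0 ltW.
    set L := Num.max (K - k%:R) u in hS hL.
    have L0 : 0 < L by rewrite /L lt_max KN kN -mulrBl mulr_gt0 // subr_gt0.
    rewrite hL ler_pdivrMr // (le_trans hS) // le_eqVlt; apply/orP; left; apply/eqP.
    by rewrite -/p kN; field; rewrite !gt_eqF.
- case: (boolP [exists i in I, exists o in O, adj G i o]) => h; last first.
    by left; have -> : x = 0 := cross_eq0 R h; rewrite mul0r.
  right; exists (mu / N); split.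
  + by rewrite divr_ge0 ?(ltW N0) // ler_pdivrMr // -lN.
  + rewrite om; have -> : mu / N * (w / N) = mu * w / N ^+ 2 by field; rewrite gt_eqF.
    by rewrite ler_pM2r ?invr_gt0.
  + rewrite om ler_pdivrMr //.
    have -> : (4 * t + w / N + mu / N) * N = 2 * K + w + (2 * K + mu).
      by rewrite KN; field; rewrite gt_eqF.
    by rewrite lerD2l /Mo h; case: ifP => _; rewrite ?ge_min lexx.
  + move=> bt; have kC : (k <= #|C|)%N by rewrite -(ler_nat R) -/K KN kN ler_pM2r.
    rewrite /Mo h kC om ler_pdivrMr //.
    have -> : (2 * t + w / N + 2 * (1 - a + b - t - mu / N)) * N =
       2 * K + w + 2 * (N - l%:R + k%:R - K - mu).
      by rewrite KN lN kN; field; rewrite gt_eqF.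
    by rewrite lerD2l ge_min lexx orbT.
Qed.

(** * Lower bound *)

Section Construction.
Local Open Scope nat_scope.

(** The edges [E0] form a clique on [a] vertices joined completely to [w] others. Among these [w]
    vertices an [l]-set [I] is chosen, and any set of [m] edges between [E0] and the set [E1] of all
    pairs not inside [I] will do; extra edges only raise degrees. *)
Lemma split_graph_in_family n m l k a w : a + w <= n -> l <= w -> k <= a ->
  a * a.-1 + 2 * (a * w) <= 2 * m -> m + 'C(l, 2) <= 'C(n, 2) ->
  exists2 G : graph n, G \in graph_family n m l k &
    a * 'C((a + w).-1, 2) + w * 'C(a, 2) <= nb_S2 G.
Proof.
move=> awn lw ka hm hl.
have [U _ cU] : exists2 U : {set 'I_n}, U \subset setT & #|U| = a + w.
  by apply: exists_subset_card; rewrite cardsT card_ord.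
have [K KU cK] : exists2 K : {set 'I_n}, K \subset U & #|K| = a.
  by apply: exists_subset_card; rewrite cU leq_addr.
have cW : #|U :\: K| = w by rewrite cardsD (setIidPr KU) cU cK addKn.
have [I IW cI] : exists2 I : {set 'I_n}, I \subset U :\: K & #|I| = l.
  by apply: exists_subset_card; rewrite cW.
pose E0 := [set e : {set 'I_n} | (e \subset U) && [exists x in K, x \in e] && (#|e| == 2)].
pose E1 := [set e : {set 'I_n} | (e \subset [set: 'I_n]) && (#|e| == 2)] :\:
           [set e : {set 'I_n} | (e \subset I) && (#|e| == 2)].
have cE1 : #|E1| = 'C(n, 2) - 'C(l, 2).
  rewrite cardsD (setIidPr _) ?cards_draws ?cI ?cardsT ?card_ord //.
  by apply/subsetP => e; rewrite !inE subsetT => /andP[].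
have [G0 EG0] : exists G0 : graph n, edges G0 = E0.
  by apply: graph_of_edges => e; rewrite inE => /andP[_ /eqP].
have adj0 u v : adj G0 u v = [&& u \in U, v \in U, (u \in K) || (v \in K) & u != v].
  rewrite /adj EG0 inE subUset !sub1set cards2 -!andbA; congr [&& _, _ & _].
  rewrite eqSS eqb1; congr (_ && _); apply/exists_inP/orP => [[x xK]|].
    by rewrite !inE => /orP[]/eqP <-; [left|right].
  by case=> h; [exists u|exists v] => //; rewrite !inE eqxx ?orbT.
have KU' v : v \in K -> v \in U by exact: (subsetP KU).
have degK v : v \in K -> degree G0 v = (a + w).-1.
  move=> vK; rewrite degree_card -cU (cardsD1 v U) (KU' _ vK) add1n /=.
  congr #|pred_of_set _|; apply/setP => u; rewrite !inE adj0 vK (KU' _ vK) /=.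
  by rewrite [u == v]eq_sym andbC.
have degW v : v \in U :\: K -> degree G0 v = a.
  rewrite inE => /andP[vK vU]; rewrite degree_card -cK.
  congr #|pred_of_set _|; apply/setP => u; rewrite !inE adj0 vU (negbTE vK) /=.
  have [uK|] := boolP (u \in K); last by rewrite andbF.
  by rewrite KU' //=; apply: contraNneq vK => ->.
have degO v : v \notin U -> degree G0 v = 0.
  move=> vU; rewrite degree_card; apply/eqP; rewrite cards_eq0; apply/eqP/setP => u.
  by rewrite !inE adj0 (negbTE vU).
have sum_by (F : 'I_n -> nat) (x y : nat) : (forall v, v \in K -> F v = x) ->
    (forall v, v \in U :\: K -> F v = y) -> (forall v, v \notin U -> F v = 0) ->
    \sum_v F v = a * x + w * y.
  move=> hx hy h0; rewrite (bigID (mem U)) /= [X in _ + X]big1 // addn0.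
  rewrite (big_setID K) /= (setIidPr KU) (eq_bigr (fun=> x)) // sum_nat_const cK.
  by rewrite (eq_bigr (fun=> y)) // sum_nat_const cW.
have cE0 : 2 * #|E0| = a * (a + w).-1 + w * a.
  by rewrite -EG0 -sum_degree (sum_by _ _ _ degK degW degO).
have E01 : E0 \subset E1.
  apply/subsetP => e; rewrite !inE subsetT => /andP[/andP[eU /exists_inP[x xK xe]] ->] /=.
  rewrite !andbT; apply/negP => /subsetP h.
  by have := subsetP IW _ (h _ xe); rewrite inE xK.
have [E [E0E EE1 cE]] : exists E : {set {set 'I_n}}, [/\ E0 \subset E, E \subset E1 & #|E| = m].
  apply: exists_subset_between => //; rewrite cE1; apply/andP; split; last by lia.
  rewrite -(leq_pmul2l (isT : 0 < 2)) cE0 (leq_trans _ hm) //.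
  by case: (a) => [|a'] //=; lia.
have [G EG] : exists G : graph n, edges G = E.
  apply: graph_of_edges => e /(subsetP EE1); rewrite !inE subsetT /=.
  by move=> /andP[_ /eqP].
have degG v : degree G0 v <= degree G v.
  rewrite /degree subset_leq_card //; apply/subsetP => e.
  by rewrite !inE EG0 EG => /andP[/(subsetP E0E) -> ->].
exists G.
  rewrite inE EG cE eqxx /=; apply/existsP; exists I; apply/and3P; split.
  - apply/forall_inP => e; rewrite EG => /(subsetP EE1); rewrite !inE subsetT /=.
    by case/andP=> h c2; apply: contra h => ->.
  - by rewrite cI.
  - apply: le_min_degree; first by lia.
    by move=> v /(subsetP IW) vW; rewrite (leq_trans ka) // -(degW _ vW).
rewrite /nb_S2 -(sum_by (fun v => 'C(degree G0 v, 2))).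
- by apply: leq_sum => v _; rewrite leq_bin2l.
- by move=> v vK; rewrite degK.
- by move=> v vW; rewrite degW.
- by move=> v vO; rewrite degO.
Qed.

End Construction.

(* Not imported above: classical_sets redefines many names of finset. *)
From mathcomp Require Import all_classical all_reals all_analysis.
Import numFieldNormedType.Exports.

(** * Densities, and the lower bound for a given number of vertices *)

Section Density.
Variable R : realType.

Lemma natr_bin2 n : 2 * 'C(n, 2)%:R = n%:R * (n%:R - 1) :> R.
Proof.
rewrite -natrM mulnC -[X in (_ * X)%N]/(2`!)%N bin_ffact.
case: n => [|n]; first by rewrite mul0r.
by rewrite ffactnS ffactn1 natrM -[X in _ = _ * (X - 1)]natr1 addrK.
Qed.

Lemma natr_bin3 n : 6 * 'C(n, 3)%:R = n%:R * (n%:R - 1) * (n%:R - 2) :> R.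
Proof.
rewrite -natrM mulnC -[X in (_ * X)%N]/(3`!)%N bin_ffact.
case: n => [|[|n]]; rewrite ?mul0r ?subrr ?mulr0 ?mul0r //.
have -> : n.+2%:R - 2 = n%:R :> R by rewrite -addn2 natrD addrK.
by rewrite !ffactnS ffactn0 muln1 !natrM mulrA -[X in _ = _ * (X - 1) * _]natr1 addrK.
Qed.

Lemma nb_S2_le_sumsq n (G : graph n) : 2 * (nb_S2 G)%:R <= (sumsq G)%:R :> R.
Proof.
rewrite /nb_S2 /sumsq !natr_sum mulr_sumr; apply: ler_sum => v _.
by rewrite natr_bin2 natrX expr2 ler_wpM2l // gerBl.
Qed.

Lemma density_S2E n (G : graph n) : density_S2 R G =
  2 * (nb_S2 G)%:R / (n%:R * (n%:R - 1) * (n%:R - 2)).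
Proof.
rewrite /density_S2 -natr_bin3.
have -> : 6 * 'C(n, 3)%:R = 2 * (3 * 'C(n, 3)%:R) :> R by ring.
(* When the binomial vanishes, both quotients have denominator 0 and are 0 by convention. *)
have [->|c0] := eqVneq ('C(n, 3)%:R : R) 0; first by rewrite !mulr0 invr0 !mulr0.
by field.
Qed.

(** For [n >= 6], passing from [n (n - 1) (n - 2)] to [n ^+ 3] costs at most the factor
    [1 + 6 / n]. *)
Lemma max_density_upper n m l k (T : R) : (6 <= n)%N -> 0 <= T ->
  (forall G, G \in graph_family n m l k -> (sumsq G)%:R <= T * n%:R ^+ 3) ->
  max_density_S2 R n m l k <= T * (1 + 6 / n%:R).
Proof.
move=> n6 T0 h; set N : R := n%:R.
have N6 : 6 <= N by rewrite ler_nat.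
have N0 : 0 < N by clear -N6; lra.
apply: bigmax_le => [|G /h hG].
  by rewrite mulr_ge0 // addr_ge0 // divr_ge0 // ltW.
have D0 : 0 < N * (N - 1) * (N - 2).
  by rewrite mulr_gt0 // ?mulr_gt0 //; clear -N6; lra.
rewrite density_S2E -/N ler_pdivrMr // (le_trans (nb_S2_le_sumsq G)) //.
rewrite (le_trans hG) // -[leRHS]mulrA ler_wpM2l //.
have -> : (1 + 6 / N) * (N * (N - 1) * (N - 2)) =
  N ^+ 3 + (3 * N * (N - 6) + 2 * N + 12).
  by field; rewrite gt_eqF.
by rewrite lerDl addr_ge0 // ?addr_ge0 // ?mulr_ge0 //; clear -N6; lra.
Qed.

Lemma max_density_lower n m l k (G : graph n) : (3 <= n)%N ->
  G \in graph_family n m l k ->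
  2 * (nb_S2 G)%:R / n%:R ^+ 3 <= max_density_S2 R n m l k.
Proof.
move=> n3 hG; apply: le_trans (le_bigmax_cond _ _ hG).
set N : R := n%:R; have N3 : 3 <= N by rewrite ler_nat.
rewrite density_S2E -/N ler_wpM2l ?mulr_ge0 //.
have N0 : 0 < N by clear -N3; lra.
rewrite lef_pV2 ?posrE ?exprn_gt0 //.
  have -> : N ^+ 3 = N * N * N by ring.
  by rewrite ler_pM // ?mulr_ge0 // ?ler_wpM2l //; clear -N3; lra.
by rewrite mulr_gt0 // ?mulr_gt0 //; clear -N3; lra.
Qed.

(** [x] and [y] are the proportions of the clique and of the independent set joined to it; [30 / n]
    covers the rounding losses. *)
Lemma max_density_ge (rho alpha x y : R) n : 17/25 <= rho <= 7/10 ->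
  1/3 <= alpha <= 2/5 -> 2/5 <= x -> alpha <= y -> x + y <= 1 -> 4/5 <= x + y ->
  x ^+ 2 + 2 * x * y = rho -> (20 <= n)%N ->
  x * (x + y) ^+ 2 + y * x ^+ 2 - 30 / n%:R <=
  max_density_S2 R n (Num.truncn (rho * ('C(n, 2))%:R))
       (Num.truncn (alpha * n%:R)) (Num.truncn (1/5 * n%:R : R)).
Proof.
move=> hr ha hx hy hxy hxy' hE n20; set N : R := n%:R.
have N20 : 20 <= N by rewrite ler_nat.
have floorP (z : R) : 0 <= z -> (Num.truncn z)%:R <= z < (Num.truncn z)%:R + 1.
  by move=> /truncn_itv; rewrite -natr1.
have N0 : 0 < N by clear -N20; lra.
have x0 : 0 <= x by clear -hx; lra.
have y0 : 0 <= y by clear -hy ha; lra.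
have /floorP/andP[A1 A2] : 0 <= x * N by rewrite mulr_ge0 // ltW.
have /floorP/andP[W1 W2] : 0 <= y * N by rewrite mulr_ge0 // ltW.
have /floorP/andP[L1 L2] : 0 <= alpha * N.
  by apply: mulr_ge0; [clear -ha; lra|exact: ltW].
have /floorP/andP[K1 K2] : 0 <= 1/5 * N by rewrite mulr_ge0 // ltW.
have /floorP/andP[M1 M2] : 0 <= rho * ('C(n, 2))%:R.
  by rewrite mulr_ge0 //; clear -hr; lra.
set A := Num.truncn (x * N) in A1 A2; set w := Num.truncn (y * N) in W1 W2.
set l := Num.truncn (alpha * N) in L1 L2 *; set k := Num.truncn _ in K1 K2 *.
set m := Num.truncn _ in M1 M2 *.
have xN : 2/5 * N <= x * N by rewrite ler_wpM2r // ltW.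
have yN : alpha * N <= y * N by rewrite ler_wpM2r // ltW.
have A7 : 7 <= (A%:R : R) by clear -A2 N20 xN; lra.
have A0 : (0 < A)%N by rewrite -(ltr0n R); clear -A7; lra.
(* Taking one vertex less than the floor of [x * N] saves a number of edges linear in [N], enough to
   stay below the rounded edge number [m]. *)
pose a := A.-1.
have aE : a%:R = A%:R - 1 :> R by rewrite /a -subn1 natrB.
have a6 : 6 <= (a%:R : R) by rewrite aE; clear -A7; lra.
have a_hi : a%:R <= x * N - 1 by rewrite aE; clear -A1; lra.
have a_lo : x * N - 2 <= a%:R by rewrite aE; clear -A2; lra.
have a1 : a.-1%:R = a%:R - 1 :> R.
  by rewrite -subn1 natrB // -(ltr0n R); clear -a6; lra.
have [G hG hnb] : exists2 G : graph n, G \in graph_family n m l k &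
    (a * 'C((a + w).-1, 2) + w * 'C(a, 2) <= nb_S2 G)%N.
  apply: split_graph_in_family.
  - rewrite -(ler_nat R) natrD -/N.
    have h : (x + y) * N <= 1 * N by rewrite ler_wpM2r // ltW.
    by clear -h a_hi W1; lra.
  - exact: le_truncn.
  - by rewrite -(ler_nat R); clear -K1 a_lo xN N20; lra.
  - rewrite -(ler_nat R) natrD !natrM a1.
    have h1 : a%:R * (a%:R - 1 + 2 * w%:R) <= (x * N - 1) * (x * N - 1 - 1 + 2 * (y * N)).
      by have w0 := ler0n R w; rewrite ler_pM //; clear -w0 a6 a_hi W1; lra.
    have h2 : (4/5 * 2 - 7/10) * N <= (3 * x + 2 * y - rho) * N.
      by rewrite ler_wpM2r ?(ltW N0) //; clear -hxy' hr x0; lra.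
    have h3 : (x ^+ 2 + 2 * x * y) * N ^+ 2 = rho * N ^+ 2 by rewrite hE.
    have h4 := natr_bin2 n; rewrite -/N in h4.
    have h5 : rho * (2 * ('C(n, 2))%:R) = rho * (N * (N - 1)) by rewrite h4.
    by clear -h1 h2 h3 h5 M2 N20; lra.
  (* There is room for [m] edges outside [I] because [7/10 + (2/5) ^+ 2 < 1]. *)
  - rewrite -(ler_nat R) natrD.
    have h4 := natr_bin2 n; rewrite -/N in h4.
    have h5 : rho * (2 * ('C(n, 2))%:R) <= 7/10 * (N * (N - 1)).
      by rewrite h4 ler_wpM2r // ?mulr_ge0 //; clear -N20 hr; lra.
    have lN : l%:R <= 2/5 * N.
      by rewrite (le_trans L1) // ler_wpM2r ?(ltW N0) //; clear -ha; lra.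
    have h6 : 2 * ('C(l, 2))%:R <= 2/5 * N * (2/5 * (N - 1)) :> R.
      rewrite natr_bin2; have [l0|l0] := posnP l.
        by rewrite l0 mul0r mulr_ge0 // mulr_ge0 //; clear -N20; lra.
      have l1 : 1 <= l%:R :> R by rewrite ler1n.
      by rewrite ler_pM //; clear -l1 lN; lra.
    have h7 : 0 <= N * (N - 1) by rewrite mulr_ge0 //; clear -N20; lra.
    by clear -h4 h5 h6 h7 M1; lra.
apply: le_trans (max_density_lower _ hG); last by rewrite (leq_trans _ n20).
have N3 : 0 < N ^+ 3 by rewrite exprn_gt0.
rewrite -/N ler_pdivlMr //.
have -> : (x * (x + y) ^+ 2 + y * x ^+ 2 - 30 / N) * N ^+ 3 =
  (x * (x + y) ^+ 2 + y * x ^+ 2) * N ^+ 3 - 30 * N ^+ 2 by field; rewrite gt_eqF.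
have hnbR : a%:R * (2 * ('C((a + w).-1, 2))%:R) + w%:R * (2 * ('C(a, 2))%:R) <=
    2 * (nb_S2 G)%:R :> R.
  by move: hnb; rewrite -(ler_nat R) natrD !natrM; clear; lra.
apply: le_trans hnbR; rewrite !natr_bin2.
have aw1 : (a + w).-1%:R = a%:R + w%:R - 1 :> R.
  rewrite -subn1 natrB ?natrD // -(ltr0n R) natrD.
  by have := ler0n R w; clear -a6; lra.
rewrite aw1.
have zN : 4/5 * N <= (x + y) * N by rewrite ler_wpM2r // ltW.
have h1 : (x * N - 2) * (((x + y) * N - 5) * ((x + y) * N - 5)) <=
   a%:R * ((a%:R + w%:R - 1) * (a%:R + w%:R - 1 - 1)).
  rewrite ler_pM //; first by clear -xN N20; lra.
    by rewrite mulr_ge0 //; clear -zN N20; lra.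
  by rewrite ler_pM //; clear -zN N20 a_lo W2; lra.
have h2 : (y * N - 1) * ((x * N - 3) * (x * N - 3)) <= w%:R * (a%:R * (a%:R - 1)).
  have yN2 : 1/3 * N <= alpha * N by rewrite ler_wpM2r ?(ltW N0) //; clear -ha; lra.
  rewrite ler_pM //; first by clear -yN yN2 N20; lra.
  - by rewrite mulr_ge0 //; clear -xN N20; lra.
  - by clear -W2; lra.
  - by rewrite ler_pM //; clear -xN N20 a_lo; lra.
apply: le_trans (lerD h1 h2).
have x1 : x <= 1 by clear -y0 hxy; lra.
have y1 : y <= 1 by clear -x0 hxy; lra.
have z0 : 0 <= x + y by clear -hxy'; lra.
have N2 : 0 <= N ^+ 2 by rewrite exprn_ge0 // ltW.
have q1 : x * (x + y) * N ^+ 2 <= 1 * 1 * N ^+ 2.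
  by rewrite ler_wpM2r // ler_pM.
have q2 : (x + y) * (x + y) * N ^+ 2 <= 1 * 1 * N ^+ 2.
  by rewrite ler_wpM2r // ler_pM.
have q3 : x * y * N ^+ 2 <= 1 * 1 * N ^+ 2 by rewrite ler_wpM2r // ler_pM.
have q4 : x * x * N ^+ 2 <= 1 * 1 * N ^+ 2 by rewrite ler_wpM2r // ler_pM.
have q5 : 0 <= y * N by rewrite mulr_ge0 // ltW.
by clear -q1 q2 q3 q4 q5 xN zN N20 N2; lra.
Qed.
End Density.

(** * Closed forms of the two extremal values and their limits *)

Lemma quasi_star_value (R : realType) (rho : R) (q := Num.sqrt (1 - rho)) : rho <= 1 ->
  2 * rho - 1 + (1 - rho) `^ (3 / 2) = 1 - 2 * q ^+ 2 + q ^+ 3.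
Proof.
move=> h; have h0 : 0 <= 1 - rho by rewrite subr_ge0.
have qE : q ^+ 2 = 1 - rho by rewrite sqr_sqrtr.
have -> : (1 - rho) `^ (3 / 2) = q ^+ 3.
  by rewrite mulrC powRrM powR12_sqrt // powR_mulrn // sqrtr_ge0.
by rewrite qE; ring.
Qed.

Lemma quasi_clique_value (R : realType) (rho alpha : R)
    (s := Num.sqrt (rho + alpha ^+ 2) - alpha) : 0 <= rho ->
  alpha ^+ 3 + (rho - alpha ^+ 2) * Num.sqrt (rho + alpha ^+ 2) =
  s ^+ 3 + 3 * alpha * s ^+ 2 + alpha ^+ 2 * s.
Proof.
move=> h; rewrite /s; set c := Num.sqrt _.
have cE : c ^+ 2 = rho + alpha ^+ 2 by rewrite sqr_sqrtr // addr_ge0 // sqr_ge0.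
have -> : rho = c ^+ 2 - alpha ^+ 2 by rewrite cE; ring.
ring.
Qed.

Lemma sqrt_split (R : rcfType) (r a : R) (s := Num.sqrt (r + a ^+ 2) - a) :
  0 <= r -> 0 <= a -> 0 <= s /\ s ^+ 2 + 2 * a * s = r.
Proof.
move=> r0 a0; have h : 0 <= r + a ^+ 2 by rewrite addr_ge0 // sqr_ge0.
rewrite /s; split.
  have : Num.sqrt (a ^+ 2) <= Num.sqrt (r + a ^+ 2) by rewrite ler_wsqrtr // lerDr.
  by rewrite sqrtr_sqr ger0_norm // subr_ge0.
by have := sqr_sqrtr h; move: (Num.sqrt _) => c cE; rewrite -[RHS](addrK (a ^+ 2)) -cE; ring.
Qed.

Local Open Scope classical_set_scope.

Lemma extremal_values_cvg (R : realType) (rn an : nat -> R) (rho alpha : R)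
    (qn := fun n => Num.sqrt (1 - rn n)) (sn := fun n => Num.sqrt (rn n + an n ^+ 2) - an n)
    (q := Num.sqrt (1 - rho)) (s := Num.sqrt (rho + alpha ^+ 2) - alpha) :
  rn @ \oo --> rho -> an @ \oo --> alpha ->
  (fun n => 1 - 2 * qn n ^+ 2 + qn n ^+ 3) @ \oo --> 1 - 2 * q ^+ 2 + q ^+ 3 /\
  (fun n => sn n ^+ 3 + 3 * an n * sn n ^+ 2 + an n ^+ 2 * sn n) @ \oo -->
    s ^+ 3 + 3 * alpha * s ^+ 2 + alpha ^+ 2 * s.
Proof.
move=> hr ha.
have expc (u : nat -> R) (l : R) k : u @ \oo --> l -> (fun n => u n ^+ k) @ \oo --> l ^+ k.
  by move=> h; exact: (continuous_cvg _ (@exprn_continuous R k l) h).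
have sqc (u : nat -> R) (l : R) : u @ \oo --> l ->
    (fun n => Num.sqrt (u n)) @ \oo --> Num.sqrt l.
  by move=> h; exact: (continuous_cvg _ (@sqrt_continuous R l) h).
have hq : qn @ \oo --> q by apply: sqc; apply: cvgB => //; exact: cvg_cst.
have hs : sn @ \oo --> s.
  by apply: cvgB => //; apply: sqc; apply: cvgD => //; exact: expc.
split.
  apply: cvgD; last exact: expc.
  apply: cvgB; first exact: cvg_cst.
  by apply: cvgM; [exact: cvg_cst|exact: expc].
apply: cvgD; last by apply: cvgM => //; exact: expc.
apply: cvgD; first exact: expc.
apply: cvgM; last exact: expc.
by apply: cvgM => //; exact: cvg_cst.
Qed.

(** * Passage to the limit *)

Unset Implicit Arguments.

Theorem theorem1p5 (R : realType) (rho alpha : R)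
    (hrho : 17 / 25 <= rho <= 7 / 10) (halpha : 1 / 3 <= alpha <= 2 / 5) :
  I_S2 rho alpha (1 / 5) =
    (Num.max (2 * rho - 1 + (1 - rho) `^ (3 / 2))
             (alpha ^+ 3 + (rho - alpha ^+ 2) * Num.sqrt (rho + alpha ^+ 2)))%:E.
Proof.
have rho0 : 0 <= rho by clear -hrho; lra.
have alpha0 : 0 <= alpha by clear -halpha; lra.
rewrite quasi_star_value ?quasi_clique_value //; last by clear -hrho; lra.
set q := Num.sqrt (1 - rho); set s := Num.sqrt _ - alpha.
set QS := 1 - _ + _; set QC := s ^+ 3 + _ + _; set T := Num.max QS QC.
have q0 : 0 <= q by exact: sqrtr_ge0.
have qE : q ^+ 2 = 1 - rho by rewrite sqr_sqrtr //; clear -hrho; lra.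
have [s0 sE] := sqrt_split rho0 alpha0; rewrite -/s in s0 sE.
have T0 : 0 <= T.
  rewrite le_max; apply/orP; left; rewrite addr_ge0 ?exprn_ge0 //.
  by rewrite qE; clear -hrho; lra.
pose h n : R := harmonic n.
have hc : h @ \oo --> (0 : R) by exact: cvg_harmonic.
have h0 n : 0 <= h n by exact: harmonic_ge0.
have hN n : h n * n.+1%:R = 1 by rewrite mulVf.
(* Graphs have [n.+1] vertices from here on. The excess [h n] over [rho] supplies the summand [n.+1]
   in the edge condition of [sumsq_upper]. *)
pose rn n := rho + h n.
pose an n : R := (Num.truncn (alpha * n.+1%:R))%:R / n.+1%:R.
have truncP (z : R) n : 0 <= z ->
    z - h n <= (Num.truncn (z * n.+1%:R))%:R / n.+1%:R <= z.
  move=> z0; have N0 : 0 < n.+1%:R :> R by rewrite ltr0n.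
  have /truncn_itv/andP[t1 t2] : 0 <= z * n.+1%:R by rewrite mulr_ge0.
  rewrite ler_pdivrMr // t1 andbT ler_pdivlMr // mulrBl hN.
  by rewrite lerBlDr natr1 ltW.
have rc : rn @ \oo --> rho.
  by rewrite -[X in _ --> X]addr0; apply: cvgD => //; exact: cvg_cst.
have ac : an @ \oo --> alpha.
  apply: (@squeeze_cvgr _ _ _ _ (fun n => alpha - h n) (fun=> alpha)).
  - by apply: nearW => n; exact: truncP.
  - by rewrite -[X in _ --> X]subr0; apply: cvgB => //; exact: cvg_cst.
  - exact: cvg_cst.
pose qn n := Num.sqrt (1 - rn n); pose sn n := Num.sqrt (rn n + an n ^+ 2) - an n.
pose QSn n := 1 - 2 * qn n ^+ 2 + qn n ^+ 3.
pose QCn n := sn n ^+ 3 + 3 * an n * sn n ^+ 2 + an n ^+ 2 * sn n.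
have [QSc QCc] : QSn @ \oo --> QS /\ QCn @ \oo --> QC := extremal_values_cvg rc ac.
pose e n := `|QSn n - QS| + `|QCn n - QC|.
have ec : e @ \oo --> (0 : R).
  have dist0 (u : nat -> R) l : u @ \oo --> l -> (fun n => `|u n - l|) @ \oo --> (0 : R).
    move=> ul; rewrite -(normr0 R); apply: cvg_norm.
    by rewrite -(subrr l); apply: cvgB => //; exact: cvg_cst.
  by rewrite -[X in _ --> X]addr0; apply: cvgD; exact: dist0.
have e_ge0 n : 0 <= e n by rewrite addr_ge0.
have QSn_le n : QSn n <= T + e n.
  have h1 : QS <= T by rewrite le_max lexx.
  have h2 := ler_norm (QSn n - QS); have h3 := normr_ge0 (QCn n - QC).
  by rewrite /e; clear -h1 h2 h3; lra.
have QCn_le n : QCn n <= T + e n.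
  have h1 : QC <= T by rewrite le_max lexx orbT.
  have h2 := ler_norm (QCn n - QC); have h3 := normr_ge0 (QSn n - QS).
  by rewrite /e; clear -h1 h2 h3; lra.
pose u n := max_density_S2 R n (Num.truncn (rho * ('C(n, 2))%:R))
       (Num.truncn (alpha * n%:R)) (Num.truncn (1 / 5 * n%:R : R)).
(* The maximal densities are shown to converge, by squeezing; the upper limit is then their
   limit. *)
suff uT : u @ \oo --> T.
  have : (fun n => (u n)%:E) @ \oo --> T%:E by apply: cvg_EFin => //; exact: nearW.
  by move=> /cvg_limn_einf_sup[_].
rewrite -(cvg_shiftS u).
have lo_c : (fun n => T - 30 * h n) @ \oo --> T - 30 * 0.
  by apply: cvgB; [exact: cvg_cst|apply: cvgM => //; exact: cvg_cst].
have hi_c : (fun n => (T + e n) * (1 + 6 * h n)) @ \oo --> (T + 0) * (1 + 6 * 0).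
  apply: cvgM; apply: cvgD; [exact: cvg_cst|exact: ec|exact: cvg_cst|].
  by apply: cvgM => //; exact: cvg_cst.
rewrite mulr0 subr0 in lo_c; rewrite mulr0 !addr0 mulr1 in hi_c.
apply: (squeeze_cvgr _ lo_c hi_c).
near=> n.
(* An error of [1/400] keeps the parameters in the wider ranges: [1/3 - 1/400 >= 33/100],
   [1/5 - 1/400 >= 9/46] and [7/10 + 1/400 <= 26/37]. *)
have n400 : (400 <= n)%N by near: n; exact: nbhs_infty_ge.
have N0 : 0 < n.+1%:R :> R by rewrite ltr0n.
have h400 : h n <= 1/400.
  have : h n * 400 <= h n * n.+1%:R by rewrite ler_wpM2l // (ler_nat R 400) leqW.
  by rewrite hN; clear; lra.
rewrite /= -/(u n.+1); apply/andP; split.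
  have lower x y : 2/5 <= x -> alpha <= y -> x + y <= 1 -> 4/5 <= x + y ->
      x ^+ 2 + 2 * x * y = rho -> x * (x + y) ^+ 2 + y * x ^+ 2 - 30 * h n <= u n.+1.
    move=> h1 h2 h3 h4 h5.
    by apply: max_density_ge => //; rewrite (leq_trans _ (leqW n400)).
  have q1 : 1/2 <= q <= 3/5.
    apply/andP; split; rewrite -(@ler_pXn2r _ 2) ?nnegrE // qE; clear -hrho; lra.
  have ha : 33/100 <= alpha <= 2/5 by clear -halpha; lra.
  have [|hs hsa _] := quasi_clique_root_range ha s0; first by rewrite sE; clear -hrho; lra.
  rewrite lerBlDr ge_max -!lerBlDr; apply/andP; split.
    (* The first value comes from [x = 1 - q], [y = q], the second one below from [x = s],
       [y = alpha]. *)
    have -> : QS = (1 - q) * (1 - q + q) ^+ 2 + q * (1 - q) ^+ 2 by rewrite /QS; ring.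
    apply: lower; try by clear -q1 halpha; lra.
    have -> : rho = 1 - q ^+ 2 by rewrite qE; ring.
    ring.
  have -> : QC = s * (s + alpha) ^+ 2 + alpha * s ^+ 2 by rewrite /QC; ring.
  apply: lower; try by clear -hs hsa halpha; lra.
  by rewrite -sE; ring.
have Te : 0 <= T + e n by rewrite addr_ge0.
rewrite [h n]/h /harmonic /=.
apply: max_density_upper => //; first by rewrite (leq_trans _ (leqW n400)).
move=> G hG.
have an_ge := truncP _ n alpha0; rewrite -/(an n) in an_ge.
have bn_ge := truncP (1/5) n; set bn := _%:R / _ in bn_ge.
have {}bn_ge : 1/5 - h n <= bn <= 1/5 by apply: bn_ge; rewrite divr_ge0.
have rn0 : 0 <= rn n by rewrite addr_ge0.
have an0 : 0 <= an n by rewrite divr_ge0.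
have [sn0 snE] := sqrt_split rn0 an0.
have rn1 : rn n <= 26/37 by rewrite /rn; clear -h400 hrho; lra.
apply: (sumsq_upper (q := qn n) (r := rn n) (s := sn n) _ hG) => //.
- by rewrite -/(an n); clear -an_ge h400 halpha; lra.
- by rewrite -/bn; clear -bn_ge h400; lra.
- by have := h0 n; rewrite /rn in rn1 *; clear -rn1 hrho; lra.
- exact: sqrtr_ge0.
- by rewrite sqr_sqrtr // subr_ge0 (le_trans rn1) //; clear; lra.
- set m := Num.truncn _.
  have C0 : 0 <= rho * ('C(n.+1, 2))%:R by rewrite mulr_ge0.
  have /truncn_itv/andP[m1 _] := C0; rewrite -/m in m1.
  have bE := natr_bin2 R n.+1.
  have E : rn n * n.+1%:R ^+ 2 = rho * n.+1%:R ^+ 2 + n.+1%:R.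
    by rewrite /rn mulrDl; congr (_ + _); rewrite expr2 mulrA hN mul1r.
  have E2 : rho * (2 * ('C(n.+1, 2))%:R) = rho * n.+1%:R ^+ 2 - rho * n.+1%:R.
    by rewrite bE; ring.
  have r0 : 0 <= rho * n.+1%:R by rewrite mulr_ge0.
  by rewrite E; clear -m1 E2 r0; lra.
- exact: QSn_le.
- exact: QCn_le.
Unshelve. all: by end_near.
Qed.
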